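(* Let $X_1,\dots,X_n$ be zero-mean jointly Gaussian real random variables, and let $a_1\in(0,\infty]$ (where $|X_1|\le\infty$ is the sure event). Then \[ \Pr(|X_1|\le 1+a_1)\,\Pr(|X_i|\le 1\ \forall i\in[n]) \;\ge\; \Pr(|X_1|\le 1)\,\Pr(|X_1|\le 1+a_1,\ |X_2|\le 1,\dots,|X_n|\le 1). \] Consequently, \[ \frac{\Pr(|X_i|\le 1\ \forall i\in[n])}{\prod_{i=1}^n\Pr(|X_i|\le 1)} \;\ge\; \sup_{a_1,\dots,a_n\in(0,\infty)} \frac{\Pr(|X_i|\le 1+a_i\ \forall i\in[n])}{\prod_{i=1}^n \Pr(|X_i|\le 1+a_i)}. \]
   Context: $[n]=\{1,\dots,n\}$. Zero-mean jointly Gaussian means $(X_1,\dots,X_n)$ is a centered Gaussian vector (possibly degenerate). *)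

(* Defs.v *)
From HB Require Import structures.
From mathcomp Require Import all_boot all_order all_algebra.
From mathcomp Require Import all_classical all_reals all_analysis.
Set Implicit Arguments. Unset Strict Implicit. Unset Printing Implicit Defensive.
Import Order.TTheory GRing.Theory Num.Theory.
Local Open Scope classical_set_scope.
Local Open Scope ring_scope.

Definition centered_gaussian {d : measure_display} {T : measurableType d}
  {R : realType} (P : probability T R) (Y : T -> R) : Prop :=
  (forall A : set R, measurable A -> P (Y @^-1` A) = \d_(0:R) A)
  \/ exists s : R, 0 < s /\
       forall A : set R, measurable A -> P (Y @^-1` A) = normal_prob 0 s A.

Definition jointly_gaussian {d : measure_display} {T : measurableType d}
  {R : realType} (P : probability T R) (m : nat) (X : 'I_m -> T -> R) : Prop :=
  (forall i, measurable_fun setT (X i)) /\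
  forall c : 'I_m -> R, centered_gaussian P (fun t => \sum_(i < m) c i * X i t).

Definition box_ratio {d : measure_display} {T : measurableType d}
  {R : realType} (P : probability T R) (m : nat) (X : 'I_m -> T -> R)
  (b : 'I_m -> R) : R :=
  fine (P [set t | forall i, `|X i t| <= 1 + b i]) /
  \prod_(i < m) fine (P [set t | `|X i t| <= 1 + b i]).

(* Main.v *)
(* Condition on X_1 = s: the other variables are b s + Z with Z centered
   Gaussian and independent of X_1, so the conditional probability of
   { |X_i| <= 1, i >= 2 } is psi(s) = P(|Z_i + b_i s| <= 1 for all i).  psi is even
   and, by the Prekopa-Leindler inequality, log-concave, hence nonincreasing in
   |s|; averaging psi over |s| <= 1 therefore gives at least its average over
   |s| <= 1 + a.  The second claim changes the thresholds one coordinate at a time.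

   Independence comes from a Cramer-Wold argument: indicators of boxes are bounded
   limits of trigonometric polynomials, whose expectations depend only on the laws
   of linear combinations, and these are determined by their second moments.
   Log-concavity is proved by induction on the dimension with the same
   conditioning, so that only the one-dimensional Prekopa-Leindler inequality
   is needed. *)
Require Import Defs.
From HB Require Import structures.
From mathcomp Require Import all_boot all_order all_algebra.
From mathcomp Require Import all_classical all_reals all_analysis.
From mathcomp Require Import measurable_realfun.
From mathcomp Require Import ring lra.
Set Implicit Arguments. Unset Strict Implicit. Unset Printing Implicit Defensive.
Import Order.TTheory GRing.Theory Num.Theory.
Import numFieldNormedType.Exports.
Local Open Scope classical_set_scope.
Local Open Scope ring_scope.

(** The covariance may be singular, so the vector has no density to work with. Each one-dimensional
    law is instead the image of the standard normal under x -> s x with s >= 0, where s = 0 gives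
    the point mass at 0, and independence is an equality of box probabilities under [P] and
    [P \x P]. All thresholds are brought to 1 by scaling: |x| <= 1 + a becomes |k x| <= 1 with k = 1
    / (1 + a), and k = 0 when a = +oo. Only the offsets of the boxes then vary. Log-concavity is
    claimed jointly in all offsets, because conditioning on one coordinate turns the others into a
    box whose offsets move with that coordinate: this is the form that the induction reproduces.
    Conditional averages would call for divisions by probabilities; the inequalities stay
    cross-multiplied until the very end, where slab probabilities are shown to be positive. *)

Lemma sum_delta (R : pzRingType) m (h : 'I_m -> R) i :
  \sum_(j < m) (j == i)%:R * h j = h i.
Proof.
by rewrite (bigD1 i)//= eqxx mul1r big1 ?addr0// => j /negPf ->; rewrite mul0r.
Qed.

Lemma indic_bool (R : pzRingType) (U : Type) (q : pred U) (u : U) :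
  \1_[set u | q u] u = (q u)%:R :> R.
Proof.
by rewrite indicE; have [h|h] := boolP (q u); [rewrite mem_set|rewrite memNset//; exact/negP].
Qed.

Section slab_measurable.
Context d (T : measurableType d) (R : realType).

Lemma measurable_slab (f : T -> R) : measurable_fun setT f ->
  measurable [set t | `|f t| <= 1].
Proof.
move=> mf; rewrite -[X in measurable X]setTI.
have mh : measurable_fun setT (fun t => `|f t|) by exact: measurableT_comp.
exact: (mh measurableT `]-oo, 1]%classic (measurable_itv _)).
Qed.

Lemma measurable_slabs (I : finType) (f : I -> T -> R) :
  (forall i, measurable_fun setT (f i)) ->
  measurable [set t | forall i, `|f i t| <= 1].
Proof.
move=> mf; rewrite (_ : [set t | _] = \bigcap_(i in [set: I]) [set t | `|f i t| <= 1]).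
  apply: fin_bigcap_measurable => [|i _]; first exact: finite_finset.
  exact: measurable_slab.
by apply/seteqP; split => t /= h i; [move=> _; exact: h|exact: (h i)].
Qed.

End slab_measurable.

(** * Normal integrals *)

Section affine.
Context {R : realType}.
Local Notation mu := (@lebesgue_measure R).

(** Uniqueness of Lebesgue measure: the rescaled pushforward gives every half-open interval its
    length. *)
Lemma lebesgue_measure_affine (s c : R) (A : set R) : 0 < s -> measurable A ->
  (s%:E * mu ((fun x : R => s * x + c)%R @^-1` A) = mu A)%E.
Proof.
move=> s0 mA.
have mf : measurable_fun setT (fun x : measurableTypeR R => s * x + c : measurableTypeR R).
  by apply: measurable_funD => //; exact: measurable_funM.
pose s' := NngNum (ltW s0).
have -> : (s%:E * mu ((fun x : R => s * x + c)%R @^-1` A) =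
   mscale s' (pushforward mu (fun x : measurableTypeR R => (s * x + c)%R : measurableTypeR R)) A)%E by [].
apply/esym/lebesgue_measure_unique => //= _ [[a b]] _ <-.
rewrite /mscale/= /pushforward.
rewrite (_ : _ @^-1` _ = `](a - c) / s, (b - c) / s]%classic); last first.
  apply/seteqP; split => x /=; rewrite !in_itv/= ltr_pdivrMr// ler_pdivlMr//;
  by rewrite ltrBlDr lerBrDr [s * _]mulrC.
rewrite !lebesgue_measure_itv/= !lte_fin ltr_pM2r ?invr_gt0// ltrBlDr subrK.
case: ifPn => ab; rewrite ?mule0//.
rewrite -!EFinD -EFinM; congr EFin; field; exact: lt0r_neq0.
Qed.

Lemma integral_affine (s c : R) (f : R -> \bar R) : 0 < s ->
  measurable_fun setT f -> (forall x, (0 <= f x)%E) ->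
  (s%:E * \int[mu]_x f (s * x + c)%R = \int[mu]_x f x)%E.
Proof.
move=> s0 mf f0.
have maff : measurable_fun setT (fun x : measurableTypeR R => s * x + c : measurableTypeR R).
  by apply: measurable_funD => //; exact: measurable_funM.
have := ge0_integral_pushforward maff mu measurableT mf (fun x _ => f0 x).
rewrite preimage_setT => <-.
pose s' := NngNum (ltW s0).
rewrite -(ge0_integral_mscale _ _ s')//.
apply: eq_measure_integral => A mA _.
exact: lebesgue_measure_affine.
Qed.

End affine.

Section normal.
Context {R : realType}.
Local Notation mu := (@lebesgue_measure R).
Local Notation p := (normal_pdf (0 : R) 1).

(** The Radon-Nikodym derivative of [normal_prob] and [normal_pdf] have the same integral over every
    measurable set, hence agree almost everywhere. *)
Lemma integral_normal_prob (m s : R) (f : R -> \bar R) :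
  measurable_fun setT f -> (forall x, (0 <= f x)%E) ->
  (\int[normal_prob m s]_x f x = \int[mu]_x (f x * (normal_pdf m s x)%:E))%E.
Proof.
move=> mf f0.
have dom := normal_prob_dominates m s.
rewrite -(Radon_Nikodym_SigmaFinite.change_of_variables dom)//.
have mrn := Radon_Nikodym_SigmaFinite.f_integrable dom.
apply: ae_eq_integral => //.
- by apply: emeasurable_funM => //; exact: measurable_int mrn.
- by apply: emeasurable_funM => //; apply/measurable_EFinP; exact: measurable_normal_pdf.
apply: ae_eqe_mul2l; apply: integral_ae_eq => //.
  by apply/measurable_EFinP; exact: measurable_normal_pdf.
by move=> E _ mE; rewrite -Radon_Nikodym_SigmaFinite.f_integral.
Qed.

Lemma normal_pdf_std (s x : R) : 0 < s -> s * normal_pdf 0 s (s * x) = p x.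
Proof.
move=> s0; rewrite !normal_pdfE ?oner_neq0 ?gt_eqF// /normal_peak /normal_fun !subr0.
rewrite expr1n mul1r -mulrnAr sqrtrM ?sqr_ge0// sqrtr_sqr gtr0_norm// invfM !mulrA.
rewrite divff ?gt_eqF// mul1r; congr (_ * expR _).
by field; exact: lt0r_neq0.
Qed.

Lemma integral_normal_prob_std (s : R) (f : R -> \bar R) : 0 < s ->
  measurable_fun setT f -> (forall x, (0 <= f x)%E) ->
  (\int[normal_prob 0 s]_x f x = \int[mu]_x (f (s * x)%R * (p x)%:E))%E.
Proof.
move=> s0 mf f0; rewrite (integral_normal_prob _ _ mf f0).
rewrite -(@integral_affine _ s 0 (fun y => f y * (normal_pdf 0 s y)%:E)%E s0); first last.
- by move=> x; rewrite mule_ge0// lee_fin normal_pdf_ge0.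
- by apply: emeasurable_funM => //; apply/measurable_EFinP; exact: measurable_normal_pdf.
rewrite -ge0_integralZl//; first last.
- by rewrite lee_fin ltW.
- by move=> x _; rewrite mule_ge0// lee_fin normal_pdf_ge0.
- apply: (measurableT_comp (f := fun y => (f y * (normal_pdf 0 s y)%:E)%E)).
  + by apply: emeasurable_funM => //; apply/measurable_EFinP; exact: measurable_normal_pdf.
  + by apply: measurable_funD => //; exact: measurable_funM.
apply: eq_integral => x _; rewrite addr0 muleCA -EFinM normal_pdf_std//.
Qed.

End normal.

Section gaussian_integral.
Context d (T : measurableType d) (R : realType) (P : probability T R).
Local Notation mu := (@lebesgue_measure R).
Local Notation p := (normal_pdf (0 : R) 1).

(** Merges the two cases of [centered_gaussian]: for the point mass at 0, s = 0 and the constant f 0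
    is integrated against a density of mass 1. *)
Lemma centered_gaussian_integral (Y : T -> R) :
  measurable_fun setT Y -> centered_gaussian P Y ->
  exists2 s : R, 0 <= s & forall f : R -> \bar R, measurable_fun setT f ->
    (forall x, (0 <= f x)%E) ->
    (\int[P]_t f (Y t) = \int[mu]_x (f (s * x)%R * (p x)%:E))%E.
Proof.
move=> mY [dY|[s [s0 sY]]].
  exists 0 => // f mf f0.
  have := ge0_integral_pushforward mY P measurableT mf (fun x _ => f0 x).
  rewrite preimage_setT => <-.
  rewrite (eq_measure_integral (\d_(0:R)))//; last by move=> A mA _; exact: (dY A mA).
  rewrite integral_dirac// diracT mul1e.
  under eq_integral do rewrite mul0r.
  rewrite ge0_integralZl ?integral_normal_pdf ?mule1//.
  - by apply/measurable_EFinP; exact: measurable_normal_pdf.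
  - by move=> x _; rewrite lee_fin normal_pdf_ge0.
exists s => [|f mf f0]; first exact: ltW.
rewrite -(integral_normal_prob_std s0 mf f0).
have mY' : measurable_fun setT (Y : T -> measurableTypeR R) by exact: mY.
have := ge0_integral_pushforward mY' P measurableT mf (fun x _ => f0 x).
rewrite preimage_setT => <-.
by apply: eq_measure_integral => A mA _; exact: (sY A mA).
Qed.

End gaussian_integral.

Section convolution.
Context {R : realType}.
Local Notation mu := (@lebesgue_measure R).
Local Notation p := (normal_pdf (0 : R) 1).

Lemma measurable_pdf (d : measure_display) (T : measurableType d) (h : T -> R) :
  measurable_fun setT h -> measurable_fun setT (fun x => (p (h x))%:E).
Proof.
move=> mh; apply/measurable_EFinP; apply: (measurableT_comp _ mh).
exact: measurable_normal_pdf.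
Qed.

Lemma pdf_ge0 x : (0 <= (p x)%:E)%E.
Proof. by rewrite lee_fin normal_pdf_ge0. Qed.

Lemma normal_pdf_stdE (x : R) : p x = normal_peak 1 * expR (- x ^+ 2 / 2).
Proof.
by rewrite normal_pdfE ?oner_neq0// /normal_fun subr0 expr1n.
Qed.

(** For u = s x + t y with x, y independent standard normals, u has standard deviation r, and given
    u, y has mean t u / r^2 and standard deviation s / r. The exponents differ by a multiple of r^2
    - (s^2 + t^2). *)
Lemma pdfM_complete_square (s t r u y : R) : 0 < s -> 0 < r ->
  r ^+ 2 = s ^+ 2 + t ^+ 2 ->
  p (s^-1 * (u - t * y)) * p y = p (r^-1 * u) * p (r / s * y + - (t * u / (r * s))).
Proof.
move=> s0 r0 rE; rewrite !normal_pdf_stdE.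
rewrite !mulrA ![normal_peak _ * expR _ * _]mulrAC -!mulrA -!expRD.
congr (_ * (_ * expR _)); apply/eqP; rewrite -subr_eq0; apply/eqP.
transitivity ((r ^+ 2 - (s ^+ 2 + t ^+ 2)) *
    (y ^+ 2 / s ^+ 2 - u ^+ 2 / (s ^+ 2 * r ^+ 2)) / 2).
  by field; rewrite !lt0r_neq0.
by rewrite rE subrr !mul0r.
Qed.

Lemma integral_pdf_affine (a c : R) : 0 < a ->
  (\int[mu]_y (p (a * y + c))%:E = a^-1%:E)%E.
Proof.
move=> a0; have := @integral_affine _ a c (fun x => (p x)%:E) a0.
rewrite integral_normal_pdf => /(_ (measurable_pdf (@measurable_id _ _ _)) pdf_ge0) h.
have ai : (a^-1%:E * a%:E = 1 :> \bar R)%E by rewrite -EFinM mulVf ?gt_eqF.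
by rewrite -[LHS]mul1e -ai -muleA h mule1.
Qed.

(* Substitute u = s x + t y, complete the square and integrate out y. *)
Lemma normal_convolution (s t : R) (f : R -> \bar R) : 0 <= s -> 0 <= t ->
  measurable_fun setT f -> (forall x, (0 <= f x)%E) ->
  (\int[mu]_x ((\int[mu]_y (f (s * x + t * y)%R * (p y)%:E)) * (p x)%:E) =
   \int[mu]_x (f (Num.sqrt (s ^+ 2 + t ^+ 2) * x)%R * (p x)%:E))%E.
Proof.
(* The substitution divides by s, so s = 0 is treated apart; the outer integrand is then a constant
   times the density. *)
rewrite le_eqVlt => /predU1P[<-|s0] t0 mf f0.
  rewrite expr0n add0r sqrtr_sqr ger0_norm//.
  under eq_integral.
    by move=> x _; under eq_integral do rewrite mul0r add0r; over.
  rewrite ge0_integralZl ?integral_normal_pdf ?mule1//.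
  - exact: measurable_pdf.
  - by move=> x _; exact: pdf_ge0.
  - by apply: integral_ge0 => y _; rewrite mule_ge0 ?pdf_ge0.
set r := Num.sqrt _.
have rE : r ^+ 2 = s ^+ 2 + t ^+ 2 by rewrite sqr_sqrtr// addr_ge0 ?sqr_ge0.
have r0 : 0 < r by rewrite sqrtr_gt0 ltr_pwDl ?sqr_ge0// exprn_gt0.
pose F1 (z : R * R) := (f (s * z.1 + t * z.2)%R * (p z.2)%:E * (p z.1)%:E)%E.
have mF1 : measurable_fun setT F1.
  apply: emeasurable_funM; last exact: measurable_pdf.
  apply: emeasurable_funM; last exact: measurable_pdf.
  apply: (measurableT_comp mf); apply: measurable_funD => //;
  exact: measurable_funM.
have F10 z : (0 <= F1 z)%E by rewrite !mule_ge0 ?pdf_ge0.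
transitivity (\int[mu]_x \int[mu]_y F1 (x, y))%E.
  apply: eq_integral => x _; rewrite -ge0_integralZr//.
  - apply: emeasurable_funM; last exact: measurable_pdf.
    by apply: (measurableT_comp mf); apply: measurable_funD => //; exact: measurable_funM.
  - by move=> y _; rewrite mule_ge0 ?pdf_ge0.
  - exact: pdf_ge0.
rewrite fubini_tonelli//.
(* The integrand in the coordinates (y, u), with Jacobian s^-1. *)
pose F2 (z : R * R) := (s^-1%:E * (f z.2 * ((p (s^-1 * (z.2 - t * z.1)))%:E * (p z.1)%:E)))%E.
have mF2 : measurable_fun setT F2.
  apply: emeasurable_funM => //; apply: emeasurable_funM.
    exact: (measurableT_comp mf).
  apply: emeasurable_funM; last exact: measurable_pdf.
  apply: measurable_pdf; apply: measurable_funM => //.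
  by apply: measurable_funB => //; exact: measurable_funM.
have si0 : 0 <= s^-1 by rewrite invr_ge0 ltW.
have F20 z : (0 <= F2 z)%E by rewrite !mule_ge0 ?pdf_ge0.
transitivity (\int[mu]_y \int[mu]_u F2 (y, u))%E.
  apply: eq_integral => y _.
  rewrite -(@integral_affine _ s (t * y) (fun u => F2 (y, u)))//; last first.
    exact: (measurableT_comp mF2).
  rewrite -ge0_integralZl//.
  - apply: eq_integral => x _; rewrite /F1 /F2/= addrK mulKf ?gt_eqF//.
    by rewrite muleA -EFinM divff ?gt_eqF// mul1e -muleA [X in (_ * X)%E]muleC.
  - apply: (measurableT_comp mF2); apply: measurable_fun_pair => //.
    by apply: measurable_funD => //; exact: measurable_funM.
  - by rewrite lee_fin ltW.
rewrite fubini_tonelli//.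
transitivity (\int[mu]_u (f u * (r^-1 * p (r^-1 * u))%:E))%E.
  apply: eq_integral => u _.
  transitivity (\int[mu]_y ((s^-1%:E * f u * (p (r^-1 * u))%:E) *
      (p (r / s * y + - (t * u / (r * s))))%:E))%E.
    apply: eq_integral => y _.
    by rewrite /F2/= -EFinM (pdfM_complete_square _ _ s0 r0 rE) EFinM !muleA.
  rewrite ge0_integralZl//.
  - rewrite integral_pdf_affine ?divr_gt0//.
    rewrite -muleA -EFinM [(s^-1%:E * _)%E]muleC -muleA -EFinM.
    congr (_ * _%:E)%E; field; rewrite !gt_eqF//.
  - by apply: measurable_pdf; apply: measurable_funD => //; exact: measurable_funM.
  - by move=> y _; exact: pdf_ge0.
  - by rewrite !mule_ge0 ?pdf_ge0.
rewrite -(@integral_affine _ r 0 (fun u => (f u * (r^-1 * p (r^-1 * u))%:E)%E))//.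
- rewrite -ge0_integralZl//.
  + apply: eq_integral => x _; rewrite addr0 mulKf ?gt_eqF//.
    by rewrite muleCA -EFinM mulrA divff ?gt_eqF// mul1r.
  + apply: emeasurable_funM.
      by apply: (measurableT_comp mf); apply: measurable_funD => //; exact: measurable_funM.
    apply/measurable_EFinP; apply: measurable_funM => //; apply/measurable_EFinP.
    apply: measurable_pdf; apply: measurable_funM => //.
    by apply: measurable_funD => //; exact: measurable_funM.
  + move=> x _; rewrite mule_ge0// lee_fin mulr_ge0 ?normal_pdf_ge0//.
    by rewrite invr_ge0 ltW.
  + by rewrite lee_fin ltW.
- apply: emeasurable_funM => //.
  apply/measurable_EFinP; apply: measurable_funM => //; apply/measurable_EFinP.
  by apply: measurable_pdf; apply: measurable_funM.
- move=> x; rewrite mule_ge0// lee_fin mulr_ge0 ?normal_pdf_ge0//.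
  by rewrite invr_ge0 ltW.
Qed.

End convolution.

Section moment.
Context {R : realType}.
Local Notation mu := (@lebesgue_measure R).
Local Notation p := (normal_pdf (0 : R) 1).

(** A finite positive [kappa] is what recovering the scale s >= 0 of a centered Gaussian from its
    second moment takes. *)
Lemma normal_second_moment : exists2 kappa : R, 0 < kappa &
  forall s : R, (\int[mu]_x (((s * x) ^+ 2)%:E * (p x)%:E) = (kappa * s ^+ 2)%:E)%E.
Proof.
have mx2 : measurable_fun setT (fun x : R => (x ^+ 2)%:E * (p x)%:E)%E.
  apply: emeasurable_funM; last exact: measurable_pdf.
  by apply/measurable_EFinP; exact: measurable_funX.
have x2ge0 (x : R) : (0 <= (x ^+ 2)%:E * (p x)%:E)%E.
  by rewrite mule_ge0 ?pdf_ge0// lee_fin sqr_ge0.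
(* Finiteness: x^2 <= 4 expR (x^2 / 4) gives x^2 p x <= 4 p (a x), and p (a x) has a finite
   integral. *)
pose a : R := (Num.sqrt 2)^-1.
have a0 : 0 < a by rewrite invr_gt0 sqrtr_gt0.
have a2 : a ^+ 2 = 2^-1 by rewrite exprVn sqr_sqrtr.
have lty : (\int[mu]_x ((x ^+ 2)%:E * (p x)%:E) < +oo)%E.
  apply: (@le_lt_trans _ _ (\int[mu]_x (4%:E * (p (a * x + 0))%:E))%E).
    apply: ge0_le_integral => //.
      apply: emeasurable_funM => //; apply: measurable_pdf.
      by apply: measurable_funD => //; exact: measurable_funM.
    move=> x _; rewrite -!EFinM lee_fin addr0 !normal_pdf_stdE.
    rewrite mulrCA [leRHS]mulrCA ler_wpM2l ?normal_peak_ge0// exprMn a2.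
    have -> : expR (- (2^-1 * x ^+ 2) / 2) = expR (x ^+ 2 / 4) * expR (- x ^+ 2 / 2).
      by rewrite -expRD; congr expR; field.
    rewrite mulrA ler_wpM2r ?expR_ge0//.
    by have := expR_ge1Dx (x ^+ 2 / 4); lra.
  rewrite ge0_integralZl//.
  - by rewrite integral_pdf_affine// -EFinM ltry.
  - apply: measurable_pdf.
    by apply: measurable_funD => //; exact: measurable_funM.
  - by move=> x _; exact: pdf_ge0.
have gt0 : (0 < \int[mu]_x ((x ^+ 2)%:E * (p x)%:E))%E.
  (* On [1, 2], an interval of length 1, x^2 p x >= p 2. *)
  apply: (@lt_le_trans _ _ (p 2)%:E).
    by rewrite lte_fin normal_pdf_stdE mulr_gt0 ?expR_gt0// normal_peak_gt0// oner_neq0.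
  apply: (@le_trans _ _ (\int[mu]_(x in `[1%R, 2%R]) ((x ^+ 2)%:E * (p x)%:E))%E); last first.
    by apply: ge0_subset_integral.
  apply: (@le_trans _ _ (\int[mu]_(x in `[1%R, 2%R]) (p 2)%:E)%E).
    rewrite integral_cst//= lebesgue_measure_itv/= lte_fin.
    by rewrite ltr1n -EFinD -EFinM lee_fin; lra.
  apply: ge0_le_integral => //.
  - by move=> x _; exact: pdf_ge0.
  - exact: measurable_funTS.
  - move=> x /=; rewrite in_itv/= => /andP[x1 x2].
    rewrite -EFinM lee_fin -[leLHS]mul1r ler_pM ?normal_pdf_ge0//.
      by rewrite -[leLHS](expr1n _ 2) ler_sqr ?nnegrE; lra.
    rewrite !normal_pdf_stdE ler_wpM2l ?normal_peak_ge0// ler_expR.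
    rewrite ler_pM2r ?invr_gt0// lerN2 ler_sqr ?nnegrE; lra.
exists (fine (\int[mu]_x ((x ^+ 2)%:E * (p x)%:E))%E).
  by rewrite fine_gt0// gt0 lty.
move=> s; rewrite mulrC EFinM fineK; last by rewrite ge0_fin_numE// ltW.
rewrite -ge0_integralZl//; last by rewrite lee_fin sqr_ge0.
by apply: eq_integral => x _; rewrite muleA -EFinM exprMn.
Qed.

End moment.

(** * Second moments and independence *)

Section covariance.
Context d (T : measurableType d) (R : realType) (P : probability T R).
Implicit Types V W Y : T -> R.

Definition square_integrable V :=
  measurable_fun setT V /\ P.-integrable setT (fun t => (V t ^+ 2)%:E).

(** The covariance, when the variables are centered. *)
Definition inner V W := (\int[P]_t (V t * W t))%R.

Lemma innerC V W : inner V W = inner W V.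
Proof. by rewrite /inner; under eq_Rintegral do rewrite mulrC. Qed.

Lemma integrable_mul V W : square_integrable V -> square_integrable W ->
  P.-integrable setT (fun t => (V t * W t)%:E).
Proof.
move=> [mV iV] [mW iW].
apply: (le_integrable measurableT _ _ (integrableD measurableT iV iW)).
  by apply/measurable_EFinP; exact: measurable_funM.
move=> t _ /=; rewrite lee_fin (@ger0_norm _ (_ + _)) ?addr_ge0 ?sqr_ge0//.
rewrite normrM -[V t ^+ 2]real_normK ?num_real// -[W t ^+ 2]real_normK ?num_real//.
have := sqr_ge0 (`|V t| - `|W t|); have := sqr_ge0 (`|V t| + `|W t|).
nra.
Qed.

Lemma square_integrableD V W : square_integrable V -> square_integrable W ->
  square_integrable (fun t => V t + W t).
Proof.
move=> sV sW; have iVW := integrable_mul sV sW.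
case: sV sW => mV iV [mW iW]; split; first exact: measurable_funD.
rewrite [X in _.-integrable _ X](_ : _ = (fun t => (V t ^+ 2)%:E + (W t ^+ 2)%:E +
  ((V t * W t)%:E + (V t * W t)%:E))%E); last first.
  by apply/funext => t; rewrite -!EFinD; congr EFin; ring.
by apply: integrableD => //; apply: integrableD.
Qed.

Lemma square_integrableZ c V : square_integrable V ->
  square_integrable (fun t => c * V t).
Proof.
move=> [mV iV]; split; first exact: measurable_funM.
rewrite [X in _.-integrable _ X](_ : _ = (fun t => (c ^+ 2)%:E * (V t ^+ 2)%:E)%E).
  exact: integrableZl.
by apply/funext => t; rewrite -EFinM exprMn.
Qed.

Lemma square_integrable0 : square_integrable (fun=> 0).
Proof.
split => //; rewrite [X in _.-integrable _ X](_ : _ = cst 0%E).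
  exact: integrable0.
by apply/funext => t; rewrite expr0n.
Qed.

Lemma square_integrable_sum m (c : 'I_m -> R) (X : 'I_m -> T -> R) :
  (forall i, square_integrable (X i)) ->
  square_integrable (fun t => \sum_(i < m) c i * X i t).
Proof.
move=> sX; have -> : (fun t => \sum_(i < m) c i * X i t) =
    \sum_(i < m) (fun t => c i * X i t).
  by apply/funext => t; rewrite fct_sumE.
elim/big_ind: _ => [|V W sV sW|i _]; first exact: square_integrable0.
- exact: square_integrableD.
- exact: square_integrableZ.
Qed.

Lemma innerDr Y V W : square_integrable Y -> square_integrable V ->
  square_integrable W ->
  inner Y (fun t => V t + W t) = inner Y V + inner Y W.
Proof.
move=> sY sV sW; rewrite /inner -RintegralD//; [|exact: integrable_mul..].
by apply: eq_Rintegral => t _; rewrite mulrDr.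
Qed.

Lemma innerZr c Y V : square_integrable Y -> square_integrable V ->
  inner Y (fun t => c * V t) = c * inner Y V.
Proof.
move=> sY sV; rewrite /inner -RintegralZl//; last exact: integrable_mul.
by apply: eq_Rintegral => t _; rewrite mulrCA.
Qed.

Lemma inner_sumr Y m (c : 'I_m -> R) (X : 'I_m -> T -> R) :
  square_integrable Y -> (forall i, square_integrable (X i)) ->
  inner Y (fun t => \sum_(i < m) c i * X i t) = \sum_(i < m) c i * inner Y (X i).
Proof.
move=> sY; elim: m c X => [|m IH] c X sX.
  rewrite big_ord0 /inner.
  under eq_Rintegral do rewrite big_ord0 mulr0.
  by rewrite /Rintegral integral0.
rewrite big_ord_recl -IH// -innerZr// -innerDr//.
- by congr inner; apply/funext => t; rewrite big_ord_recl.
- exact: square_integrableZ.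
- by apply: (square_integrable_sum (fun i => c (lift ord0 i)) (X := fun i => X (lift ord0 i))).
Qed.

Lemma inner_ge0 V : 0 <= inner V V.
Proof. by rewrite /inner Rintegral_ge0// => t _; rewrite -expr2 sqr_ge0. Qed.

Lemma inner_sqD V W : square_integrable V -> square_integrable W ->
  inner (fun t => V t + W t) (fun t => V t + W t) =
  inner V V + 2 * inner V W + inner W W.
Proof.
move=> sV sW; have sD := square_integrableD sV sW.
rewrite innerDr// [inner _ V]innerC [inner _ W]innerC !innerDr// [inner W V]innerC.
ring.
Qed.

Lemma inner_null Y W : square_integrable Y -> square_integrable W ->
  inner Y Y = 0 -> inner Y W = 0.
Proof.
move=> sY sW Y0; apply/eqP/negPn/negP => YW0.
(* Chosen so that the square of W + c Y, which is [inner W W + 2 c inner Y W] because Y has square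
   0, equals -1. *)
pose c := - (inner W W + 1) / (2 * inner Y W).
have sc := square_integrableZ c sY.
have := inner_ge0 (fun t => W t + c * Y t).
rewrite inner_sqD// (innerZr c sW sY) (innerZr c sc sY).
rewrite (innerC (fun t => c * Y t) Y) (innerZr c sY sY) Y0 (innerC W Y).
rewrite (_ : _ + _ = -1); first by rewrite oppr_ge0 ler10.
by rewrite /c; field; exact: YW0.
Qed.

End covariance.

Section independence.
Context d (T : measurableType d) (R : realType) (P : probability T R).
Local Notation mu := (@lebesgue_measure R).
Local Notation p := (normal_pdf (0 : R) 1).
Implicit Types V W Y : T -> R.

Lemma gaussian_square_integrable V : measurable_fun setT V ->
  centered_gaussian P V -> square_integrable P V.
Proof.
move=> mV gV; split => //.
have [s s0 sV] := centered_gaussian_integral mV gV.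
have [k k0 kE] := @normal_second_moment R.
have msq : measurable_fun setT (fun x : R => (x ^+ 2)%:E).
  by apply/measurable_EFinP; exact: measurable_funX.
apply/integrableP; split; first by apply/measurable_EFinP; exact: measurable_funX.
under eq_integral do rewrite gee0_abs ?lee_fin ?sqr_ge0//.
rewrite (sV (fun x => (x ^+ 2)%:E))// ?kE ?ltry// => x.
by rewrite lee_fin sqr_ge0.
Qed.

(** A centered Gaussian law is fixed by its second moment. For independent copies the convolution
    has scale sqrt (s^2 + t^2); the vanishing covariance gives Y + W the same second moment, hence
    the same scale. *)
Lemma product_gaussian Y W (f : R -> \bar R) :
  measurable_fun setT Y -> measurable_fun setT W ->
  centered_gaussian P Y -> centered_gaussian P W ->
  centered_gaussian P (fun t => Y t + W t) -> inner P Y W = 0 ->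
  measurable_fun setT f -> (forall x, (0 <= f x)%E) ->
  (\int[P \x P]_z f (Y z.1 + W z.2)%R = \int[P]_t f (Y t + W t)%R)%E.
Proof.
move=> mY mW gY gW gV YW0 mf f0.
have mV : measurable_fun setT (fun t => Y t + W t) by exact: measurable_funD.
have [s s0 sY] := centered_gaussian_integral mY gY.
have [t t0 tW] := centered_gaussian_integral mW gW.
have [r r0 rV] := centered_gaussian_integral mV gV.
have [k k0 kE] := @normal_second_moment R.
have msq : measurable_fun setT (fun x : R => (x ^+ 2)%:E).
  by apply/measurable_EFinP; exact: measurable_funX.
have sq0 (x : R) : (0 <= (x ^+ 2)%:E)%E by rewrite lee_fin sqr_ge0.
have innerE V u : (forall f : R -> \bar R, measurable_fun setT f ->
    (forall x, (0 <= f x)%E) ->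
    (\int[P]_t f (V t) = \int[mu]_x (f (u * x)%R * (p x)%:E))%E) ->
    inner P V V = k * u ^+ 2.
  by move=> /(_ _ msq sq0); rewrite kE => h; rewrite /inner /Rintegral h.
have rE : r = Num.sqrt (s ^+ 2 + t ^+ 2).
  apply/eqP; rewrite -(@eqrXn2 _ 2)// ?sqrtr_ge0// sqr_sqrtr ?addr_ge0 ?sqr_ge0//.
  rewrite -(inj_eq (mulfI (lt0r_neq0 k0))) mulrDr -(innerE _ _ rV).
  rewrite inner_sqD ?YW0 ?mulr0 ?addr0 ?(innerE _ _ sY) ?(innerE _ _ tW)//.
  exact: gaussian_square_integrable.
  exact: gaussian_square_integrable.
pose F z := f (Y z.1 + W z.2).
have mF : measurable_fun setT F.
  apply: (measurableT_comp mf); apply: measurable_funD.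
    exact: (measurableT_comp mY).
  exact: (measurableT_comp mW).
have F0 z : (0 <= F z)%E by exact: f0.
rewrite (fubini_tonelli1 F mF F0) (rV f mf f0).
pose G (z : R * R) := (f (z.1 + t * z.2)%R * (p z.2)%:E)%E.
have mG : measurable_fun setT G.
  apply: emeasurable_funM; last exact: measurable_pdf.
  by apply: (measurableT_comp mf); apply: measurable_funD => //; exact: measurable_funM.
have G0 z : (0 <= G z)%E by rewrite mule_ge0 ?pdf_ge0.
transitivity (\int[P]_x fubini_F mu G (Y x))%E.
  apply: eq_integral => x _; rewrite /fubini_F /F/=.
  rewrite (tW (fun u => f (Y x + u)))//.
  by apply: (measurableT_comp mf); exact: measurable_funD.
rewrite sY.
- by rewrite rE -normal_convolution.
- exact: measurable_fun_fubini_tonelli_F.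
- by move=> x; apply: integral_ge0 => y _.
Qed.

End independence.

(** * Box probabilities are determined by linear combinations *)

Section cutoff.
Context {R : realType}.
Implicit Types (x y u : R).

Lemma sqr_sin_le y : sin y ^+ 2 <= y ^+ 2.
Proof.
wlog y0 : y / 0 < y => [hw|].
  have [/hw//|y0|<-] := ltgtP 0 y; last by rewrite sin0.
  by rewrite -[y]opprK sinN sqrrN [leRHS]sqrrN hw// oppr_gt0.
have [c _] := MVT y0 (fun x _ => is_derive_sin x)
  (continuous_subspaceT (@continuous_sin R)).
rewrite sin0 !subr0 => ->; rewrite exprMn ler_piMl ?sqr_ge0//.
Qed.

Lemma cvg_natM_sin x : (fun n => n.+1%:R * sin (x / n.+1%:R)) @ \oo --> x.
Proof.
(* The sequence is x times the difference quotient of [sin] at 0 along x / n.+1, which requires x !=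
   0. *)
have [->|x0] := eqVneq x 0.
  rewrite (_ : (fun _ => _) = cst 0); first exact: cvg_cst.
  by apply/funext => n; rewrite mul0r sin0 mulr0.
have [d dE] := is_derive_sin (0 : R).
rewrite /derivable /derive in d dE.
have {}d : h^-1 *: (sin (h *: 1 + 0) - sin 0) @[h --> 0^'] --> (1 : R).
  by move: d; rewrite dE cos0.
have /cvgr_dnbhsP h := d.
have {h}/= h := h (fun n => x / n.+1%:R).
rewrite (_ : (fun n => _) = (fun n : nat => x * ((x / n.+1%:R)^-1 *:
    (sin ((x / n.+1%:R) *: 1 + 0) - sin 0)))); last first.
  apply/funext => n; rewrite sin0 subr0 addr0 invf_div !scaler1.
  rewrite /GRing.scale/=; have : n.+1%:R != 0 :> R by rewrite pnatr_eq0.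
  move: n.+1%:R => N N0.
  by field.
rewrite -[X in _ --> X]mulr1; apply: cvgMr; apply: h; split.
  by move=> n; rewrite mulf_neq0// invr_neq0.
by rewrite -[X in _ --> X](mulr0 x); apply: cvgMr; exact: cvg_harmonic.
Qed.

Lemma bernoulli_ge u (m : nat) : 0 <= u <= 1 -> 1 - m%:R * u <= (1 - u) ^+ m.
Proof.
move=> /andP[u0 u1]; elim: m => [|m IH]; first by rewrite mul0r subr0 expr0.
rewrite exprS -natr1; apply: (@le_trans _ _ ((1 - u) * (1 - m%:R * u))).
  by have := mulr_ge0 (ler0n R m) (sqr_ge0 u); nra.
by rewrite ler_wpM2l// subr_ge0.
Qed.

(** Forces (1 - u)^m to 0 when m u tends to +oo, while [bernoulli_ge] forces it to 1 when m u tends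
    to 0. *)
Lemma bernoulli_le u (m : nat) : 0 <= u <= 1 -> (1 - u) ^+ m * (1 + m%:R * u) <= 1.
Proof.
move=> /andP[u0 u1]; elim: m => [|m IH]; first by rewrite mul0r addr0 expr0 mulr1.
apply: le_trans IH; rewrite exprSr -mulrA ler_wpM2l ?exprn_ge0 ?subr_ge0//.
by rewrite -natr1; have := mulr_ge0 (ler0n R m) (sqr_ge0 u); nra.
Qed.

Lemma bernoulli_expD (del : R) (m : nat) : 0 <= del -> del * m%:R <= (1 + del) ^+ m.
Proof.
move=> d0; apply: (@le_trans _ _ (1 + del * m%:R)); first by rewrite lerDr.
elim: m => [|m IH]; first by rewrite mulr0 addr0 expr0.
rewrite exprS -natr1; apply: (@le_trans _ _ ((1 + del) * (1 + del * m%:R))).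
  by have := mulr_ge0 (ler0n R m) (sqr_ge0 del); nra.
by rewrite ler_wpM2l// addr_ge0.
Qed.

(* A sequence of trigonometric polynomials converging boundedly to the
   indicator of [-1, 1] at every point, endpoints included: with N = n + 1,
   u = sin(x/N)^(2N) and m = N^(2N-1), m u = (N sin(x/N))^(2N) / N tends to 0
   or +oo according as |x| <= 1 or |x| > 1, hence (1 - u)^m tends to 1 or 0. *)
Definition cutoff (n : nat) x :=
  (1 - sin (x / n.+1%:R) ^+ (2 * n.+1)) ^+ (n.+1 ^ (2 * n).+1).

Let u_in01 n x : 0 <= sin (x / n.+1%:R) ^+ (2 * n.+1) <= 1.
Proof.
rewrite exprM exprn_ge0 ?sqr_ge0//= exprn_ile1 ?sqr_ge0//.
Qed.

Lemma cutoff_in01 n x : 0 <= cutoff n x <= 1.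
Proof.
have /andP[u0 u1] := u_in01 n x.
by rewrite exprn_ge0 ?subr_ge0//= exprn_ile1 ?subr_ge0// gerBl.
Qed.

Let mu_n n x : (n.+1 ^ (2 * n).+1)%:R * sin (x / n.+1%:R) ^+ (2 * n.+1) =
  ((n.+1%:R * sin (x / n.+1%:R)) ^+ 2) ^+ n.+1 / n.+1%:R.
Proof.
have N0 : n.+1%:R != 0 :> R by rewrite pnatr_eq0.
rewrite -exprM exprMn natrX mulrAC; congr (_ * _).
by apply: (mulIf N0); rewrite divfK// mulnS addSn addnC addn1 -exprSr.
Qed.

Lemma cvg_cutoff x : cutoff n x @[n --> \oo] --> ((`|x| <= 1)%R%:R : R).
Proof.
have [x1|x1] := leP `|x| 1 => /=.
(* Here |N sin (x / N)| <= |x| <= 1, hence m u <= 1 / N. *)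
- apply: (@squeeze_cvgr _ _ _ _ (fun n => 1 - n.+1%:R^-1) (cst 1)).
  + near=> n; rewrite /cst; have /andP[_ ->] := cutoff_in01 n x.
    rewrite andbT; apply: le_trans (bernoulli_ge _ (u_in01 n x)).
    rewrite lerB// mu_n ler_piMl ?invr_ge0// exprn_ile1 ?sqr_ge0//.
    rewrite exprMn; apply: (@le_trans _ _ (n.+1%:R ^+ 2 * (x / n.+1%:R) ^+ 2)).
      by rewrite ler_wpM2l ?sqr_ge0// sqr_sin_le.
    rewrite -exprMn mulrC divfK// -real_normK ?num_real// exprn_ile1//.
  + rewrite -[X in _ --> X]subr0; apply: cvgB; first exact: cvg_cst.
    exact: cvg_harmonic.
  + exact: cvg_cst.
- have [del del0 delx] : exists2 del, 0 < del & 1 + del < `|x|.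
    by exists ((`|x| - 1) / 2); lra.
  (* Once |N sin (x / N)| >= 1 + del, its N-th power is at least del N, so m u >= (del N)^2 / N =
     del^2 N. *)
  apply: (@squeeze_cvgr _ _ _ _ (cst 0) (fun n => (del ^+ 2)^-1 * n.+1%:R^-1)).
  + near=> n; rewrite /cst; have /andP[-> _] := cutoff_in01 n x.
    rewrite /= -invfM -[leRHS]mul1r ler_pdivlMr; last first.
      by rewrite mulr_gt0// exprn_gt0.
    apply: le_trans (bernoulli_le (n.+1 ^ (2 * n).+1) (u_in01 n x)).
    apply: ler_wpM2l; first by have /andP[] := cutoff_in01 n x.
    rewrite mu_n; apply: ler_wpDl => //.
    rewrite ler_pdivlMr// -mulrA -expr2 -exprMn.
    have : 1 + del <= `|n.+1%:R * sin (x / n.+1%:R)|.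
      near: n; apply: (cvgr_ge `|x|); last exact: delx.
      by apply: cvg_norm; exact: cvg_natM_sin.
    set a := _ * sin _ => da.
    rewrite -exprM mulnC exprM -[leRHS]real_normK ?num_real// normrX.
    rewrite ler_sqr ?nnegrE ?exprn_ge0 ?mulr_ge0 ?(ltW del0)//.
    apply: le_trans (bernoulli_expD n.+1 (ltW del0)) _.
    by rewrite lerXn2r ?nnegrE// addr_ge0// (ltW del0).
  + exact: cvg_cst.
  + rewrite -[X in _ --> X](mulr0 (del ^+ 2)^-1); apply: cvgMr.
    exact: cvg_harmonic.
Unshelve. all: by end_near. 
Qed.

End cutoff.

(* The Cramer-Wold principle for boxes.  [Lin] relates each linear combination
   on [T] to its counterpart on [T']; the equality of the integrals of
   [cos (L + th)] for all phases [th] is that of the characteristic functions. *)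
Section uniqueness.
Context d (T : measurableType d) d' (T' : measurableType d') (R : realType).
Variables (P : probability T R) (Q : probability T' R).
Variable Lin : (T -> R) -> (T' -> R) -> Prop.
Hypothesis LinM : forall L L', Lin L L' ->
  measurable_fun setT L /\ measurable_fun setT L'.
Hypothesis Lin0 : Lin (fun=> 0) (fun=> 0).
Hypothesis LinD : forall L1 L1' L2 L2', Lin L1 L1' -> Lin L2 L2' ->
  Lin (fun t => L1 t + L2 t) (fun t => L1' t + L2' t).
Hypothesis LinZ : forall c L L', Lin L L' ->
  Lin (fun t => c * L t) (fun t => c * L' t).
Hypothesis Lin_cos : forall L L' th, Lin L L' ->
  \int[P]_t cos (L t + th) = \int[Q]_t cos (L' t + th).

(** The same trigonometric polynomial built in parallel on both spaces. There is no constructor for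
    products, so that equality of integrals follows by linearity; closure under products is [trigM],
    which linearizes a product of cosines. *)
Inductive trig_poly : (T -> R) -> (T' -> R) -> Prop :=
| trig_cos L L' th of Lin L L' :
    trig_poly (fun t => cos (L t + th)) (fun t => cos (L' t + th))
| trigD F F' G G' of trig_poly F F' & trig_poly G G' :
    trig_poly (fun t => F t + G t) (fun t => F' t + G' t)
| trigZ c F F' of trig_poly F F' :
    trig_poly (fun t => c * F t) (fun t => c * F' t).

Lemma trig_cst c : trig_poly (fun=> c) (fun=> c).
Proof.
have h := trigZ c (trig_cos 0 Lin0).
have cE (U : Type) : (fun=> c) = (fun _ : U => c * cos (0 + 0)) :> (U -> R).
  by apply/funext => t; rewrite addr0 cos0 mulr1.
by rewrite !cE.
Qed.

Lemma trigM F F' G G' : trig_poly F F' -> trig_poly G G' ->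
  trig_poly (fun t => F t * G t) (fun t => F' t * G' t).
Proof.
move=> tF tG; elim: tF => [L L' th LL'|F1 F1' F2 F2' _ h1 _ h2|c F1 F1' _ h1].
- elim: tG => [K K' ph KK'|G1 G1' G2 G2' _ h1 _ h2|c G1 G1' _ h1].
  + have h := trigZ 2^-1 (trigD (trig_cos (th + ph) (LinD LL' KK'))
      (trig_cos (th - ph) (LinD LL' (LinZ (-1) KK')))).
    have E (x y : R) : cos (x + th) * cos (y + ph) =
        2^-1 * (cos (x + y + (th + ph)) + cos (x + -1 * y + (th - ph))).
      rewrite (_ : x + y + (th + ph) = (x + th) + (y + ph)); last by ring.
      rewrite (_ : x + -1 * y + (th - ph) = (x + th) - (y + ph)); last by ring.
      by move: (x + th) (y + ph) => a b; rewrite cosD cosB; field.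
    have -> : (fun t => cos (L t + th) * cos (K t + ph)) = fun t =>
        2^-1 * (cos (L t + K t + (th + ph)) + cos (L t + -1 * K t + (th - ph))).
      by apply/funext => t; exact: E.
    have -> : (fun t => cos (L' t + th) * cos (K' t + ph)) = fun t =>
        2^-1 * (cos (L' t + K' t + (th + ph)) + cos (L' t + -1 * K' t + (th - ph))).
      by apply/funext => t; exact: E.
    exact: h.
  + under eq_fun do rewrite mulrDr; under [X in trig_poly _ X]eq_fun do rewrite mulrDr.
    exact: trigD.
  + under eq_fun do rewrite mulrCA; under [X in trig_poly _ X]eq_fun do rewrite mulrCA.
    exact: trigZ.
- under eq_fun do rewrite mulrDl; under [X in trig_poly _ X]eq_fun do rewrite mulrDl.
  exact: trigD.
- under eq_fun do rewrite -mulrA; under [X in trig_poly _ X]eq_fun do rewrite -mulrA.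
  exact: trigZ.
Qed.

Lemma trigX F F' n : trig_poly F F' ->
  trig_poly (fun t => F t ^+ n) (fun t => F' t ^+ n).
Proof.
move=> tF; elim: n => [|n IH].
  under eq_fun do rewrite expr0; under [X in trig_poly _ X]eq_fun do rewrite expr0.
  exact: trig_cst.
under eq_fun do rewrite exprS; under [X in trig_poly _ X]eq_fun do rewrite exprS.
exact: trigM.
Qed.

Lemma trig_prod (I : Type) (r : seq I) (F : I -> T -> R) (F' : I -> T' -> R) :
  (forall i, trig_poly (F i) (F' i)) ->
  trig_poly (fun t => \prod_(i <- r) F i t) (fun t => \prod_(i <- r) F' i t).
Proof.
move=> tF; elim: r => [|i r IH].
  under eq_fun do rewrite big_nil; under [X in trig_poly _ X]eq_fun do rewrite big_nil.
  exact: trig_cst.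
under eq_fun do rewrite big_cons; under [X in trig_poly _ X]eq_fun do rewrite big_cons.
exact: trigM.
Qed.

(** Since sin y = cos (y - pi / 2), [cutoff] is a polynomial in a single cosine, and the offset [v]
    is absorbed in its phase. *)
Lemma trig_cutoff L L' v n : Lin L L' ->
  trig_poly (fun t => cutoff n (L t + v)) (fun t => cutoff n (L' t + v)).
Proof.
move=> LL'.
have h := trigX (n.+1 ^ (2 * n).+1) (trigD (trig_cst 1) (trigZ (-1)
  (trigX (2 * n.+1) (trig_cos (v / n.+1%:R - pi / 2) (LinZ n.+1%:R^-1 LL'))))).
have E x : cutoff n (x + v) = (1 + -1 * cos (n.+1%:R^-1 * x +
    (v / n.+1%:R - pi / 2)) ^+ (2 * n.+1)) ^+ (n.+1 ^ (2 * n).+1).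
  by rewrite /cutoff mulN1r addrA cosBpihalf mulrDl [x / _]mulrC.
under eq_fun do rewrite E; under [X in trig_poly _ X]eq_fun do rewrite E.
exact: h.
Qed.

Let bounded_measurable d0 (T0 : measurableType d0) (F : T0 -> R) :=
  measurable_fun setT F /\ exists C, forall t, `|F t| <= C.

Let bm_integrable d0 (T0 : measurableType d0) (P0 : probability T0 R) (F : T0 -> R) :
  bounded_measurable F -> P0.-integrable setT (EFin \o F).
Proof.
move=> [mF [C FC]]; apply: (le_integrable measurableT (g := cst C%:E)).
- exact/measurable_EFinP.
- by move=> t _ /=; rewrite lee_fin (le_trans (FC t))// ler_norm.
- exact: finite_measure_integrable_cst.
Qed.

Let bmD d0 (T0 : measurableType d0) (F G : T0 -> R) :
  bounded_measurable F -> bounded_measurable G ->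
  bounded_measurable (fun t => F t + G t).
Proof.
move=> [mF [C FC]] [mG [D GD]]; split; first exact: measurable_funD.
by exists (C + D) => t; rewrite (le_trans (ler_normD _ _))// lerD.
Qed.

Let bmZ d0 (T0 : measurableType d0) c (F : T0 -> R) :
  bounded_measurable F -> bounded_measurable (fun t => c * F t).
Proof.
move=> [mF [C FC]]; split; first exact: measurable_funM.
by exists (`|c| * C) => t; rewrite normrM ler_wpM2l.
Qed.

Let bm_cos d0 (T0 : measurableType d0) (L : T0 -> R) th : measurable_fun setT L ->
  bounded_measurable (fun t => cos (L t + th)).
Proof.
move=> mL; split; last by exists 1 => t; exact: cos_max.
apply: (@measurableT_comp _ _ _ _ _ _ (cos : R -> R)).
  exact: continuous_measurable_fun (@continuous_cos R).
exact: measurable_funD.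
Qed.

Let trig_bm F F' : trig_poly F F' -> [/\ bounded_measurable F,
  bounded_measurable F' & \int[P]_t F t = \int[Q]_t F' t].
Proof.
elim=> [L L' th LL'|F1 F1' F2 F2' _ [b1 b1' e1] _ [b2 b2' e2]|c F1 F1' _ [b1 b1' e1]].
- have [mL mL'] := LinM LL'; split; [exact: bm_cos|exact: bm_cos|exact: Lin_cos].
- split; [exact: bmD|exact: bmD|].
  by rewrite !RintegralD ?e1 ?e2//; exact: bm_integrable.
- split; [exact: bmZ|exact: bmZ|].
  by rewrite !RintegralZl ?e1//; exact: bm_integrable.
Qed.

(** Dominated convergence: the products of cutoffs lie in [0, 1] and tend everywhere to the
    indicator of the box. *)
Let cvg_box (I : finType) d0 (T0 : measurableType d0) (P0 : probability T0 R)
    (U : I -> T0 -> R) (v : I -> R) : (forall i, measurable_fun setT (U i)) ->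
  (forall n, bounded_measurable (fun t => \prod_i cutoff n (U i t + v i))) ->
  (\int[P0]_t (\prod_i cutoff n (U i t + v i))%:E)%E @[n --> \oo] -->
  P0 [set t | forall i, `|U i t + v i| <= 1].
Proof.
move=> mU bm; set A := [set _ | _].
have mA : measurable A.
  by apply: measurable_slabs => i; exact: measurable_funD.
have limE t : \prod_i cutoff n (U i t + v i) @[n --> \oo] --> (\1_A t : R).
  have -> : \1_A t = \prod_i (`|U i t + v i| <= 1)%R%:R :> R.
    rewrite indicE; have [tA|tA] := boolP (t \in A).
      by rewrite big1// => i _; move: tA; rewrite inE => /(_ i) ->.
    have /existsNP[i /negP/negbTE ti] : ~ A t by move: tA; rewrite notin_setE.
    by rewrite (bigD1 i)//= ti mul0r.
  apply: cvg_big => [|i _]; last exact: cvg_cutoff.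
  by move=> [x y]; exact: mul_continuous.
have -> : P0 A = (\int[P0]_t (\1_A t)%:E)%E by rewrite integral_indic// setIT.
have [] := @dominated_convergence _ _ R P0 setT measurableT
  (fun n t => (\prod_i cutoff n (U i t + v i))%:E) (fun t => (\1_A t)%:E) (cst 1%E).
- by move=> n; apply/measurable_EFinP; case: (bm n).
- by apply/measurable_EFinP; exact: measurable_indic.
- apply: aeW => t _; apply/fine_cvgP; split; first exact: nearW.
  exact: limE.
- exact: finite_measure_integrable_cst.
- apply: aeW => t n _; rewrite lee_fin ger0_norm.
    by apply: Num.Theory.prodr_ile1 => i _; exact: cutoff_in01.
  by apply: prodr_ge0 => i _; have /andP[] := cutoff_in01 n (U i t + v i).
by move=> _ _.
Qed.

(** The approximating integrals agree term by term, so their limits do. Convergence at the endpoints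
    matters: a degenerate variable may charge the boundary of the box. *)
Lemma box_unique (I : finType) (U : I -> T -> R) (V : I -> T' -> R) (v : I -> R) :
  (forall i, Lin (U i) (V i)) ->
  P [set t | forall i, `|U i t + v i| <= 1] =
  Q [set t | forall i, `|V i t + v i| <= 1].
Proof.
move=> UV; pose tp n := trig_bm (trig_prod (index_enum I)
  (fun i => trig_cutoff (v i) n (UV i))).
have hP := @cvg_box I _ _ P U v (fun i => (LinM (UV i)).1)
  (fun n => let: And3 h _ _ := tp n in h).
have hQ := @cvg_box I _ _ Q V v (fun i => (LinM (UV i)).2)
  (fun n => let: And3 _ h _ := tp n in h).
have E : (fun n => \int[P]_t (\prod_i cutoff n (U i t + v i))%:E)%E =
    (fun n => \int[Q]_t (\prod_i cutoff n (V i t + v i))%:E)%E.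
  apply/funext => n; have [b b' e] := tp n.
  rewrite -[LHS]fineK; last exact: (integrable_fin_num _ (bm_integrable _ b)).
  rewrite -[RHS]fineK; last exact: (integrable_fin_num _ (bm_integrable _ b')).
  by congr EFin; exact: e.
by rewrite -E in hQ; exact: (cvg_unique _ hP hQ).
Qed.

End uniqueness.

(** * Conditioning on one variable *)

Section decomposition.
Context d (T : measurableType d) (R : realType) (P : probability T R).
Implicit Types (V W Y : T -> R).

(** The hypothesis only speaks of nonnegative functions, so it is applied to 1 + cos. *)
Lemma eq_Rintegral_cos d1 (T1 : measurableType d1) d2 (T2 : measurableType d2)
    (P1 : probability T1 R) (P2 : probability T2 R) (L1 : T1 -> R) (L2 : T2 -> R) th :
  measurable_fun setT L1 -> measurable_fun setT L2 ->
  (forall f : R -> \bar R, measurable_fun setT f -> (forall x, (0 <= f x)%E) ->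
    (\int[P1]_t f (L1 t) = \int[P2]_t f (L2 t))%E) ->
  \int[P1]_t cos (L1 t + th) = \int[P2]_t cos (L2 t + th).
Proof.
move=> m1 m2 h.
have mcos : measurable_fun setT (cos : R -> R).
  exact: continuous_measurable_fun (@continuous_cos R).
have icos d0 (T0 : measurableType d0) (P0 : probability T0 R) (L : T0 -> R) :
    measurable_fun setT L -> P0.-integrable setT (fun t => (cos (L t + th))%:E).
  move=> mL; apply: (le_integrable measurableT (g := cst 1%:E)).
  - apply/measurable_EFinP; apply: (measurableT_comp mcos); exact: measurable_funD.
  - by move=> t _ /=; rewrite lee_fin normr1 cos_max.
  - exact: finite_measure_integrable_cst.
have c1 d0 (T0 : measurableType d0) (P0 : probability T0 R) (L : T0 -> R) :
    measurable_fun setT L ->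
    \int[P0]_t (1 + cos (L t + th)) = 1 + \int[P0]_t cos (L t + th).
  move=> mL; rewrite RintegralD//.
  - by rewrite /Rintegral integral_cst//= probability_setT mule1.
  - exact: finite_measure_integrable_cst.
  - exact: icos.
apply: (addrI 1); rewrite -!c1// /Rintegral; congr fine.
apply: (h (fun x => (1 + cos (x + th))%:E)).
  apply/measurable_EFinP; apply: measurable_funD => //.
  by apply: (measurableT_comp mcos); exact: measurable_funD.
by move=> x; rewrite lee_fin addrC -lerBlDr sub0r cos_geN1.
Qed.

(** V and -V have the same second moment, hence the same scale. *)
Lemma gaussian_opp_law V (f : R -> \bar R) : measurable_fun setT V ->
  centered_gaussian P V -> centered_gaussian P (fun t => - V t) ->
  measurable_fun setT f -> (forall x, (0 <= f x)%E) ->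
  (\int[P]_t f (V t) = \int[P]_t f (- V t)%R)%E.
Proof.
move=> mV gV gN mf f0.
have mN : measurable_fun setT (fun t => - V t) by exact: measurableT_comp.
have [s s0 sV] := centered_gaussian_integral mV gV.
have [t t0 tN] := centered_gaussian_integral mN gN.
have [k k0 kE] := @normal_second_moment R.
rewrite (sV f mf f0) (tN f mf f0); suff -> : s = t by [].
have msq : measurable_fun setT (fun x : R => (x ^+ 2)%:E).
  by apply/measurable_EFinP; exact: measurable_funX.
have sq0 (x : R) : (0 <= (x ^+ 2)%:E)%E by rewrite lee_fin sqr_ge0.
apply/eqP; rewrite -(@eqrXn2 _ 2)// -(inj_eq (mulfI (lt0r_neq0 k0))).
rewrite -[_ == _](inj_eq (@EFin_inj R)) -!kE -(sV (fun x => (x ^+ 2)%:E) msq sq0).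
rewrite -(tN (fun x => (x ^+ 2)%:E) msq sq0).
by under [X in _ == X]eq_integral do rewrite sqrrN.
Qed.

(** The conditioning variable Y is kept apart from the family: it is the first coordinate in
    [box_log_concave] and an arbitrary one in [slab_box]. *)
Definition jointly_gaussian2 m Y (X : 'I_m -> T -> R) :=
  [/\ measurable_fun setT Y, forall i, measurable_fun setT (X i) &
   forall a (c : 'I_m -> R),
     centered_gaussian P (fun t => a * Y t + \sum_(i < m) c i * X i t)].

Section residual.
Variables (m : nat) (Y : T -> R) (X : 'I_m -> T -> R).
Hypothesis YX : jointly_gaussian2 Y X.

(* When [Y] is degenerate, [inner P Y Y = 0] and the quotient is [0], which is
   the right value since [inner P Y (X i)] vanishes as well. *)
Definition regression i := inner P Y (X i) / inner P Y Y.
Definition residual i t := X i t - regression i * Y t.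

Let mY : measurable_fun setT Y. Proof. by case: YX. Qed.
Let mX i : measurable_fun setT (X i). Proof. by case: YX. Qed.

Lemma measurable_residual i : measurable_fun setT (residual i).
Proof. by apply: measurable_funB => //; exact: measurable_funM. Qed.

Lemma sum_residual c t : \sum_(i < m) c i * residual i t =
  - (\sum_(i < m) c i * regression i) * Y t + \sum_(i < m) c i * X i t.
Proof.
rewrite mulNr addrC mulr_suml -sumrB; apply: eq_bigr => i _.
by rewrite /residual mulrBr mulrA.
Qed.

Lemma jointly_gaussian_residual : jointly_gaussian P residual.
Proof.
split=> [i|c]; first exact: measurable_residual.
under eq_fun do rewrite sum_residual.
by case: YX => _ _; exact.
Qed.

Let sqY : square_integrable P Y.
Proof.
apply: gaussian_square_integrable => //; case: YX => _ _ /(_ 1 (fun=> 0)).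
rewrite (_ : (fun t => _) = Y)//; apply/funext => t.
by rewrite mul1r big1 ?addr0// => i _; rewrite mul0r.
Qed.

Let sqX i : square_integrable P (X i).
Proof.
apply: gaussian_square_integrable => //; case: YX => _ _ /(_ 0 (fun j => (j == i)%:R)).
rewrite (_ : (fun t => _) = X i)//; apply/funext => t.
by rewrite mul0r add0r (sum_delta (X^~ t)).
Qed.

Lemma inner_residual i : inner P Y (residual i) = 0.
Proof.
rewrite (_ : residual i = fun t => X i t + (- regression i) * Y t); last first.
  by apply/funext => t; rewrite mulNr.
rewrite innerDr//; last exact: square_integrableZ.
rewrite innerZr// /regression; have [Y0|Y0] := eqVneq (inner P Y Y) 0.
  by rewrite Y0 mulr0 addr0 inner_null.
by rewrite mulNr divfK// subrr.
Qed.

Let gaussY a : centered_gaussian P (fun t => a * Y t).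
Proof.
case: YX => _ _ /(_ a (fun=> 0)).
rewrite (_ : (fun t => _) = fun t => a * Y t)//; apply/funext => t.
by rewrite big1 ?addr0// => i _; rewrite mul0r.
Qed.

Lemma product_gaussian_residual a c (f : R -> \bar R) :
  measurable_fun setT f -> (forall x, (0 <= f x)%E) ->
  (\int[P \x P]_z f (a * Y z.1 + \sum_(i < m) c i * residual i z.2)%R =
   \int[P]_t f (a * Y t + \sum_(i < m) c i * residual i t)%R)%E.
Proof.
have [mZ gZ] := jointly_gaussian_residual.
have sqZ i : square_integrable P (residual i).
  apply: gaussian_square_integrable => //; have := gZ (fun j => (j == i)%:R).
  rewrite (_ : (fun t => _) = residual i)//; apply/funext => t.
  exact: (sum_delta (residual^~ t)).
move=> mf f0.
have sqaY := square_integrableZ a sqY.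
have sqW := square_integrable_sum c sqZ.
apply: (@product_gaussian _ _ _ P (fun t => a * Y t)
  (fun t => \sum_(i < m) c i * residual i t)) => //.
- exact: measurable_funM.
- by case: sqW.
- under eq_fun do rewrite sum_residual addrA -mulrDl.
  by case: YX => _ _; exact.
- rewrite innerC innerZr// innerC inner_sumr// big1 ?mulr0// => i _.
  by rewrite inner_residual mulr0.
Qed.

(* [Y] is independent of the residuals of its regression: on [P \x P], the
   vector of the [regression i * Y z.1 + residual i z.2] has the law of [X]. *)
Lemma box_decomposition (k v0 : R) (v : 'I_m -> R) :
  P [set t | `|k * Y t + v0| <= 1 /\ forall i, `|X i t + v i| <= 1] =
  (\int[P]_t ((`|k * Y t + v0| <= 1)%R%:R%:E *
    P [set t' | forall i, (`|residual i t' + (regression i * Y t + v i)| <= 1)%R]))%E.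
Proof.
(* On the product space, each X i in the combination is replaced by
   [regression i * Y z.1 + residual i z.2]. *)
pose Lin L L' := exists a c, L = (fun t => a * Y t + \sum_(i < m) c i * X i t) /\
  L' = (fun z : T * T => (a + \sum_(i < m) c i * regression i) * Y z.1 +
    \sum_(i < m) c i * residual i z.2).
have LinE a c t : a * Y t + \sum_(i < m) c i * X i t =
    (a + \sum_(i < m) c i * regression i) * Y t + \sum_(i < m) c i * residual i t.
  by rewrite sum_residual; ring.
have LinM L L' : Lin L L' -> measurable_fun setT L /\ measurable_fun setT L'.
  move=> [a [c [-> ->]]]; split; apply: measurable_funD.
  + exact: measurable_funM.
  + by apply: measurable_sum => i; exact: measurable_funM.
  + by apply: measurable_funM => //; exact: (measurableT_comp mY).
  + apply: measurable_sum => i; apply: measurable_funM => //.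
    exact: (measurableT_comp (measurable_residual i)).
have Lin0 : Lin (fun=> 0) (fun=> 0).
  exists 0, (fun=> 0); split; apply/funext => t;
  by rewrite !big1 ?addr0 ?mul0r ?addr0// => i _; rewrite mul0r.
have LinD L1 L1' L2 L2' : Lin L1 L1' -> Lin L2 L2' ->
  Lin (fun t => L1 t + L2 t) (fun t => L1' t + L2' t).
  move=> [a1 [c1 [-> ->]]] [a2 [c2 [-> ->]]].
  exists (a1 + a2), (fun i => c1 i + c2 i); split; apply/funext => t.
    under [in RHS]eq_bigr do rewrite mulrDl.
    by rewrite big_split/=; ring.
  under [in RHS]eq_bigr do rewrite mulrDl.
  under [X in _ = _ + X]eq_bigr do rewrite mulrDl.
  by rewrite !big_split/=; ring.
have LinZ c L L' : Lin L L' -> Lin (fun t => c * L t) (fun t => c * L' t).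
  move=> [a1 [c1 [-> ->]]].
  exists (c * a1), (fun i => c * c1 i); split; apply/funext => t.
    under [in RHS]eq_bigr do rewrite -mulrA.
    by rewrite -mulr_sumr; ring.
  under [in RHS]eq_bigr do rewrite -mulrA.
  under [X in _ = _ + X]eq_bigr do rewrite -mulrA.
  by rewrite -!mulr_sumr; ring.
have Lin_cos L L' th : Lin L L' ->
    \int[P]_t cos (L t + th) = \int[(P \x P)%E]_t cos (L' t + th).
  move=> LL'; have [mL mL'] := LinM _ _ LL'.
  apply: eq_Rintegral_cos => // f mf f0.
  case: LL' => a [c [-> ->]].
  rewrite (product_gaussian_residual _ _ mf f0).
  by apply: eq_integral => t _; rewrite LinE.
have LinY : Lin (fun t => k * Y t) (fun z => k * Y z.1).
  exists k, (fun=> 0); split; apply/funext => t;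
  by rewrite !big1 ?addr0// => i _; rewrite mul0r.
have LinX i : Lin (X i) (fun z => regression i * Y z.1 + residual i z.2).
  exists 0, (fun j => (j == i)%:R); split; apply/funext => t.
    by rewrite (sum_delta (X^~ t)) mul0r add0r.
  by rewrite sum_delta (sum_delta (residual^~ t.2)) add0r.
(* The index [None] carries the constraint on k Y, so that the whole event is a single box. *)
pose U (o : option 'I_m) := if o is Some i then X i else fun t => k * Y t.
pose V (o : option 'I_m) := if o is Some i
  then fun z : T * T => regression i * Y z.1 + residual i z.2 else fun z => k * Y z.1.
pose w (o : option 'I_m) := if o is Some i then v i else v0.
have UV o : Lin (U o) (V o) by case: o => [i|]; [exact: LinX|exact: LinY].
have := box_unique LinM Lin0 LinD LinZ Lin_cos w UV.
rewrite (_ : [set t | forall o, `|U o t + w o| <= 1] =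
  [set t | `|k * Y t + v0| <= 1 /\ forall i, `|X i t + v i| <= 1]); last first.
  apply/seteqP; split => t /=.
    by move=> h; split; [exact: (h None)|move=> i; exact: (h (Some i))].
  by move=> [h0 h] [i|]; [exact: h|exact: h0].
move=> ->.
(* The product measure integrates the measures of sections; the section at t is empty unless |k Y t
   + v0| <= 1. *)
rewrite /product_measure1/=; apply: eq_integral => t _ /=.
have [h|h] := boolP (`|k * Y t + v0| <= 1).
  have E i t' : residual i t' + (regression i * Y t + v i) =
      regression i * Y t + residual i t' + v i by rewrite addrCA addrA.
  rewrite mul1e; congr (P _); apply/seteqP; split => t' /=.
    by rewrite /xsection/= inE => H i; rewrite E; exact: (H (Some i)).
  by rewrite /xsection/= inE => H [i|]//; have := H i; rewrite E.
rewrite mul0e (_ : xsection _ _ = set0) ?measure0//.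
apply/seteqP; split => t' //=; rewrite /xsection/= inE => /(_ None).
by rewrite /V /w/= (negbTE h).
Qed.

End residual.

(** Z and -Z have the same law: [Lin] pairs each combination with its opposite. *)
Lemma box_symmetry m (Z : 'I_m -> T -> R) (w : 'I_m -> R) : jointly_gaussian P Z ->
  P [set t | forall i, `|Z i t - w i| <= 1] = P [set t | forall i, `|Z i t + w i| <= 1].
Proof.
move=> [mZ gZ].
pose Lin (L L' : T -> R) := exists c, L = (fun t => \sum_(i < m) c i * Z i t) /\
  L' = (fun t => - (\sum_(i < m) c i * Z i t)).
have mL c : measurable_fun setT (fun t => \sum_(i < m) c i * Z i t).
  by apply: measurable_sum => i; exact: measurable_funM.
have LinM L L' : Lin L L' -> measurable_fun setT L /\ measurable_fun setT L'.
  by move=> [c [-> ->]]; split => //; exact: measurableT_comp.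
have Lin0 : Lin (fun=> 0) (fun=> 0).
  exists (fun=> 0); split; apply/funext => t;
  by rewrite big1 ?oppr0// => i _; rewrite mul0r.
have LinD L1 L1' L2 L2' : Lin L1 L1' -> Lin L2 L2' ->
  Lin (fun t => L1 t + L2 t) (fun t => L1' t + L2' t).
  move=> [c1 [-> ->]] [c2 [-> ->]].
  exists (fun i => c1 i + c2 i); split; apply/funext => t;
    under [in RHS]eq_bigr do rewrite mulrDl;
  by rewrite big_split/= ?opprD.
have LinZ c L L' : Lin L L' -> Lin (fun t => c * L t) (fun t => c * L' t).
  move=> [c1 [-> ->]].
  exists (fun i => c * c1 i); split; apply/funext => t;
    under [in RHS]eq_bigr do rewrite -mulrA;
  by rewrite -mulr_sumr ?mulrN.
have Lin_cos L L' th : Lin L L' ->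
    \int[P]_t cos (L t + th) = \int[P]_t cos (L' t + th).
  move=> LL'; have [mL1 mL'] := LinM _ _ LL'.
  apply: eq_Rintegral_cos => // f mf f0.
  case: LL' => c [-> ->]; apply: gaussian_opp_law => //.
  have := gZ (fun i => - c i).
  by under eq_fun do (under eq_bigr do rewrite mulNr; rewrite sumrN).
have UV i : Lin (Z i) (fun t => - Z i t).
  by exists (fun j => (j == i)%:R); split; apply/funext => t; rewrite (sum_delta (Z^~ t)).
rewrite (box_unique LinM Lin0 LinD LinZ Lin_cos (fun i => - w i) UV).
congr (P _); apply/seteqP; split => t /= h i; have := h i;
by rewrite -opprD normrN.
Qed.

End decomposition.

(** * One-dimensional Prekopa-Leindler inequality *)

Section prekopa_leindler.
Context {R : realType}.
Local Notation mu := (@lebesgue_measure R).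
Implicit Types (A B C : set R) (f g h : R -> R).

(** A lies in [sup A - K, sup A]. *)
Lemma lebesgue_measure_le_diameter A (K : R) : measurable A -> A !=set0 ->
  (forall x y, A x -> A y -> x <= y -> y - x <= K) -> (mu A <= K%:E)%E.
Proof.
move=> mA [x0 Ax0] AK.
have K0 : 0 <= K by have := AK _ _ Ax0 Ax0 (lexx _); rewrite subrr.
have dA x y : A x -> A y -> y <= x + K.
  move=> Ax Ay; have [xy|/ltW yx] := leP x y; last by rewrite (le_trans yx)// lerDl.
  by rewrite -lerBlDl AK.
have ubA x : A x -> ubound A (x + K) by move=> Ax y; exact: dA.
have hsA : has_sup A by split; [exists x0|exists (x0 + K); exact: ubA].
have lbA : lbound A (sup A - K).
  by move=> x Ax; rewrite lerBlDr ge_sup//; [exists x0|exact: ubA].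
apply: (@le_trans _ _ (mu `[sup A - K, sup A]%classic)).
  apply: le_measure; rewrite ?inE//.
  by move=> x Ax /=; rewrite in_itv/= lbA//= (ub_le_sup hsA.2).
by rewrite /= lebesgue_measure_itv/=; case: ifPn => _; rewrite -?EFinD lee_fin; lra.
Qed.

Lemma brunn_minkowski_itv A B C (l : R) : 0 < l < 1 ->
  measurable A -> measurable B -> measurable C ->
  A !=set0 -> B !=set0 -> is_interval A -> is_interval B ->
  (forall x y, A x -> B y -> C ((1 - l) * x + l * y)) ->
  ((1 - l)%:E * mu A + l%:E * mu B <= mu C)%E.
Proof.
move=> /andP[l0 l1] mA mB mC A0 B0 iA iB ABC.
have l1' : 0 < 1 - l by rewrite subr_gt0.
(* C contains the whole segment from the combination of the left ends to that of the right ends. *)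
have key a1 a2 b1 b2 : A a1 -> A a2 -> a1 <= a2 -> B b1 -> B b2 -> b1 <= b2 ->
    (((1 - l) * (a2 - a1) + l * (b2 - b1))%:E <= mu C)%E.
  move=> Aa1 Aa2 a12 Bb1 Bb2 b12.
  pose z1 := (1 - l) * a1 + l * b1; pose z2 := (1 - l) * a2 + l * b2.
  have -> : (1 - l) * (a2 - a1) + l * (b2 - b1) = z2 - z1 by rewrite /z1 /z2; ring.
  have : z1 <= z2 by rewrite /z1 /z2 lerD// ler_pM2l.
  rewrite le_eqVlt => /predU1P[->|z12]; first by rewrite subrr measure_ge0.
  have -> : (z2 - z1)%:E = mu `[z1, z2]%classic.
    by rewrite lebesgue_measure_itv/= lte_fin z12 EFinB.
  apply: le_measure; rewrite ?inE// => z /=; rewrite in_itv/= => /andP[z1z zz2].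
  (* The relative position of z in [z1, z2], reused in [a1, a2] and in [b1, b2]. *)
  pose th := (z - z1) / (z2 - z1).
  have d0 : 0 < z2 - z1 by rewrite subr_gt0.
  have th0 : 0 <= th by rewrite divr_ge0// subr_ge0// ltW.
  have th1 : th <= 1 by rewrite ler_pdivrMr// mul1r lerD2r.
  have -> : z = (1 - l) * (a1 + th * (a2 - a1)) + l * (b1 + th * (b2 - b1)).
    have : th * (z2 - z1) = z - z1 by rewrite /th divfK// gt_eqF.
    by rewrite /z1 /z2; lra.
  have a12' : 0 <= a2 - a1 by rewrite subr_ge0.
  have b12' : 0 <= b2 - b1 by rewrite subr_ge0.
  by apply: ABC; [apply: (iA a1 a2)|apply: (iB b1 b2)] => //; nra.
have [->|Cfin] := eqVneq (mu C) +oo%E; first by rewrite leey.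
have muC0 : (0 <= mu C)%E by [].
move: (mu C) key Cfin muC0 => [c| |]// key _ _.
(* The bound is first optimized over pairs in A with a pair of B fixed; [hB] then optimizes over
   B. *)
have hA b1 b2 : B b1 -> B b2 -> b1 <= b2 ->
    (mu A <= ((c - l * (b2 - b1)) / (1 - l))%:E)%E.
  move=> Bb1 Bb2 b12; apply: lebesgue_measure_le_diameter => // a1 a2 Aa1 Aa2 a12.
  rewrite ler_pdivlMr// mulrC lerBrDr -lee_fin; exact: key.
have [b0 Bb0] := B0.
have Aoo := hA _ _ Bb0 Bb0 (lexx _).
have A0' : (0 <= mu A)%E by [].
move: (mu A) hA Aoo A0' => [al| |]// hA _ _.
have hB : (mu B <= ((c - (1 - l) * al) / l)%:E)%E.
  apply: lebesgue_measure_le_diameter => // b1 b2 Bb1 Bb2 b12.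
  have := hA _ _ Bb1 Bb2 b12; rewrite lee_fin !ler_pdivlMr//; lra.
have B0' : (0 <= mu B)%E by [].
move: (mu B) hB B0' => [be| |]//; rewrite !lee_fin ler_pdivlMr// => hB _.
by lra.
Qed.

(** The part of the subgraph at heights in [0, 1[; its horizontal sections are the superlevel sets
    of f. *)
Let below f : set (R * R) := [set z | (0 <= z.2 < 1) /\ z.2 < f z.1].

Let measurable_below f : measurable_fun setT f -> measurable (below f).
Proof.
move=> mf; rewrite /below (_ : [set _ | _] =
  (snd @^-1` `[0, 1[%classic) `&` [set z : R * R | z.2 < f z.1]); last first.
  by apply/seteqP; split => z /=; rewrite in_itv.
apply: measurableI.
  by rewrite -[X in measurable X]setTI; exact: measurable_snd.
have mlt : measurable_fun setT (fun z : R * R => z.2 < f z.1).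
  by apply: measurable_fun_ltr => //; exact: (measurableT_comp mf).
by have := mlt measurableT [set true]; rewrite setTI; exact.
Qed.

Let ysection_below f t : 0 <= t < 1 -> ysection (below f) t = [set x | t < f x].
Proof.
by move=> t01; apply/seteqP; split => x; rewrite /ysection/= inE /below/=;
  [case|split].
Qed.

(** Layer-cake formula: Tonelli for the indicator of [below f], whose vertical sections are [0, min
    (f x) 1[. *)
Let integral_below f : measurable_fun setT f -> (forall x, 0 <= f x) ->
  (\int[mu]_t mu (ysection (below f) t) = \int[mu]_x (Num.min (f x) 1)%:E)%E.
Proof.
move=> mf f0; have mS := measurable_below mf.
have muE (r : R) : 0 <= r -> mu `[0, r[%classic = r%:E.
  rewrite lebesgue_measure_itv/= lte_fin.
  by rewrite le_eqVlt => /predU1P[<-|->]; rewrite ?ltxx ?sube0.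
have := @fubini_tonelli _ _ _ _ R mu mu (fun z => (\1_(below f) z)%:E).
move=> /(_ _ _)/esym => E; transitivity (\int[mu]_t \int[mu]_x (\1_(below f) (x, t))%:E)%E.
  apply: eq_integral => t _.
  rewrite (_ : (fun x => _) = fun x => (\1_(ysection (below f) t) x)%:E).
    have mt : measurable (ysection (below f) t) by exact: measurable_ysection.
    by rewrite (integral_indic mu measurableT mt) setIT.
  by apply/funext => x; rewrite !indicE mem_ysection.
rewrite E.
- apply: eq_integral => x _.
  rewrite (_ : (fun t => _) = fun t => (\1_(`[0, Num.min (f x) 1[%classic) t)%:E).
    have : 0 <= Num.min (f x) 1 by rewrite le_min f0 ler01.
    move: (Num.min _ _) => r r0.
    rewrite (integral_indic mu measurableT (measurable_itv `[0, r[)) setIT.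
    exact: muE.
  apply/funext => t; rewrite !indicE; congr ((nat_of_bool _)%:R%:E).
  apply/idP/idP; rewrite !inE /below/= in_itv/= lt_min.
    by move=> [/andP[-> ->] ->].
  by move=> /andP[t0 /andP[tf t1]]; split; [apply/andP; split|].
- apply/measurable_EFinP; exact: measurable_indic.
- by move=> z; rewrite lee_fin.
Qed.

(* With both suprema equal to 1, every superlevel set at height [t < 1] is
   nonempty, so Brunn-Minkowski can be integrated over [t]. *)
Lemma prekopa_leindler_normalized f g h (l : R) : 0 < l < 1 ->
  measurable_fun setT f -> measurable_fun setT g -> measurable_fun setT h ->
  (forall x, 0 <= f x <= 1) -> (forall x, 0 <= g x <= 1) -> (forall x, 0 <= h x) ->
  (forall t, t < 1 -> exists x, t < f x) -> (forall t, t < 1 -> exists x, t < g x) ->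
  (forall t, is_interval [set x | t < f x]) -> (forall t, is_interval [set x | t < g x]) ->
  (forall t x y, 0 <= t -> t < f x -> t < g y -> t < h ((1 - l) * x + l * y)) ->
  ((1 - l)%:E * (\int[mu]_x (f x)%:E) + l%:E * (\int[mu]_x (g x)%:E) <=
   \int[mu]_x (h x)%:E)%E.
Proof.
move=> l01 mf mg mh f01 g01 h0 fsup gsup If Ig fgh.
have /andP[l0 l1] := l01; have l1' : 0 < 1 - l by rewrite subr_gt0.
have E (k : R -> R) : measurable_fun setT k -> (forall x, 0 <= k x <= 1) ->
    (\int[mu]_x (k x)%:E = \int[mu]_t mu (ysection (below k) t))%E.
  move=> mk k01; rewrite integral_below//; last by move=> x; have /andP[] := k01 x.
  by apply: eq_integral => x _; rewrite min_l//; have /andP[] := k01 x.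
have my (k : R -> R) : measurable_fun setT k -> measurable_fun setT (fun t => mu (ysection (below k) t)).
  by move=> mk; exact: (measurable_fun_ysection mu (measurable_below mk)).
rewrite (E f)// (E g)//; apply: (@le_trans _ _ (\int[mu]_t mu (ysection (below h) t))%E).
  rewrite -!ge0_integralZl//; [|exact: my|by rewrite lee_fin ltW|exact: my|by rewrite lee_fin ltW].
  rewrite -ge0_integralD//; first last.
  - by apply: emeasurable_funM => //; exact: my.
  - by move=> t _; rewrite mule_ge0// lee_fin ltW.
  - by apply: emeasurable_funM => //; exact: my.
  - by move=> t _; rewrite mule_ge0// lee_fin ltW.
  apply: ge0_le_integral => //.
  - by move=> t _; rewrite adde_ge0// mule_ge0// lee_fin ltW.
  - by apply: emeasurable_funD; apply: emeasurable_funM => //; exact: my.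
  - exact: my.
  move=> t _; have [t01|t01] := boolP (0 <= t < 1).
    have mys (k : R -> R) : measurable_fun setT k -> measurable (ysection (below k) t).
      by move=> mk; exact: measurable_ysection (measurable_below mk).
    have /andP[t0 t1] := t01.
    apply: brunn_minkowski_itv => //; [exact: mys|exact: mys|exact: mys|..];
      rewrite !ysection_below//; [exact: fsup|exact: gsup|].
    by move=> x y /=; exact: fgh.
  have e0 (k : R -> R) : ysection (below k) t = set0.
    by apply/seteqP; split => x //=; rewrite /ysection/= inE /below/= (negbTE t01) => -[].
  by rewrite !e0 measure0 !mule0 adde0.
(* The function h may exceed 1; truncation only lowers its integral. *)
rewrite integral_below//; apply: ge0_le_integral => //.
- by move=> x _; rewrite lee_fin le_min h0 ler01.
- by apply/measurable_EFinP; exact: measurable_minr.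
- exact/measurable_EFinP.
- by move=> x _; rewrite lee_fin ge_min lexx.
Qed.

End prekopa_leindler.

(** * Weighted geometric means *)

Section geometric_mean.
Context {R : realType}.
Implicit Types (l x y : R).

(** For 0 < l < 1 it vanishes as soon as one argument does, so log-concavity can be stated without
    logarithms for functions that take the value 0. *)
Definition geomean l x y := powR x (1 - l) * powR y l.

Lemma geomean_ge0 l x y : 0 <= geomean l x y.
Proof. by rewrite mulr_ge0 ?powR_ge0. Qed.

Lemma geomean0l l y : l < 1 -> geomean l 0 y = 0.
Proof. by move=> l1; rewrite /geomean powR0 ?mul0r// subr_eq0 gt_eqF. Qed.

Lemma geomean0r l x : 0 < l -> geomean l x 0 = 0.
Proof. by move=> l0; rewrite /geomean powR0 ?mulr0// gt_eqF. Qed.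

Lemma geomeanM l x1 y1 x2 y2 : 0 <= x1 -> 0 <= y1 -> 0 <= x2 -> 0 <= y2 ->
  geomean l (x1 * x2) (y1 * y2) = geomean l x1 y1 * geomean l x2 y2.
Proof. by move=> *; rewrite /geomean !powRM// mulrACA. Qed.

Lemma geomeanxx l x : 0 <= x -> geomean l x x = x.
Proof.
move=> x0; rewrite /geomean -powRD ?subrK ?powRr1//.
by rewrite oner_eq0.
Qed.

Lemma le_geomean l x1 y1 x2 y2 : 0 < l < 1 -> 0 <= x1 <= x2 -> 0 <= y1 <= y2 ->
  geomean l x1 y1 <= geomean l x2 y2.
Proof.
move=> /andP[l0 l1] /andP[x0 x12] /andP[y0 y12].
rewrite ler_pM ?powR_ge0// ge0_ler_powR ?nnegrE ?subr_ge0//;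
  by [exact: ltW|exact: le_trans x12|exact: le_trans y12].
Qed.

Lemma min_le_geomean l x y : 0 < l < 1 -> 0 <= x -> 0 <= y ->
  Num.min x y <= geomean l x y.
Proof.
move=> l01 x0 y0; have m0 : 0 <= Num.min x y by rewrite le_min x0.
rewrite -[leLHS](geomeanxx l m0).
by apply: le_geomean => //; rewrite m0 ge_min lexx ?orbT.
Qed.

(** Young's inequality for x^(1 - l) and y^l with exponents 1 / (1 - l) and 1 / l. *)
Lemma geomean_le_arith l x y : 0 < l < 1 -> 0 <= x -> 0 <= y ->
  geomean l x y <= (1 - l) * x + l * y.
Proof.
move=> /andP[l0 l1] x0 y0; have l1' : 0 < 1 - l by rewrite subr_gt0.
have := @conjugate_powR _ (powR x (1 - l)) (powR y l) (1 - l)^-1 l^-1.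
rewrite -!powRrM !divff ?gt_eqF// !powRr1// !invrK ![x * _]mulrC ![y * _]mulrC.
by apply; rewrite ?powR_ge0 ?invr_gt0// subrK.
Qed.

Lemma geomean_expR l x y : geomean l (expR x) (expR y) = expR ((1 - l) * x + l * y).
Proof. by rewrite /geomean -!expRM -expRD ![_ * (1 - l)]mulrC [y * l]mulrC. Qed.

End geometric_mean.

Section prekopa_leindler.
Context {R : realType}.
Local Notation mu := (@lebesgue_measure R).

Definition log_concave (f : R -> R) := forall l x y, 0 < l < 1 ->
  geomean l (f x) (f y) <= f ((1 - l) * x + l * y).

Lemma log_concave_is_interval f t : (forall x, 0 <= f x) -> log_concave f ->
  is_interval [set x | t < f x].
Proof.
move=> f0 fc x y /= tx ty z /andP[]; rewrite le_eqVlt => /predU1P[<-//|xz].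
rewrite le_eqVlt => /predU1P[->//|zy].
have xy : 0 < y - x by rewrite subr_gt0 (lt_trans xz).
pose l := (z - x) / (y - x).
have l01 : 0 < l < 1.
  rewrite /l ltr_pdivlMr// ltr_pdivrMr// mul0r mul1r subr_gt0 xz/=.
  by rewrite ltrD2r.
have -> : z = (1 - l) * x + l * y.
  have : l * (y - x) = z - x by rewrite /l divfK// gt_eqF.
  by lra.
apply: lt_le_trans (fc l x y l01); apply: lt_le_trans (min_le_geomean l01 _ _) => //.
by rewrite lt_min tx.
Qed.

(** Divide f and g by their suprema a and b, and h by [geomean l a b]: the normalized inequality
    bounds an arithmetic mean, which dominates the geometric one. Log-concavity of f and g makes
    their superlevel sets intervals. *)
Lemma prekopa_leindler (f g h : R -> R) (l : R) : 0 < l < 1 ->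
  measurable_fun setT f -> measurable_fun setT g -> measurable_fun setT h ->
  (forall x, 0 <= f x) -> (forall x, 0 <= g x) -> (forall x, 0 <= h x) ->
  has_ubound (range f) -> has_ubound (range g) ->
  log_concave f -> log_concave g ->
  (forall x y, geomean l (f x) (g y) <= h ((1 - l) * x + l * y)) ->
  (\int[mu]_x (f x)%:E < +oo)%E -> (\int[mu]_x (g x)%:E < +oo)%E ->
  (\int[mu]_x (h x)%:E < +oo)%E ->
  geomean l (\int[mu]_x f x) (\int[mu]_x g x) <= \int[mu]_x h x.
Proof.
move=> l01 mf mg mh f0 g0 h0 ubf ubg fc gc fgh foo goo hoo.
have /andP[l0 l1] := l01.
have H0 : 0 <= \int[mu]_x h x by apply: Rintegral_ge0 => x _; exact: h0.
have I0 (k : R -> R) : (forall x, k x <= 0) -> (forall x, 0 <= k x) ->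
    \int[mu]_x k x = 0.
  move=> k0 k1; rewrite /Rintegral integral0_eq// => x _.
  by congr EFin; apply/eqP; rewrite eq_le k0 k1.
(* If f or g vanishes identically, it cannot be normalized, but the left-hand side is then 0. *)
have [fneg|/existsNP[xf /negP]] := pselect (forall x, f x <= 0).
  by rewrite (I0 f)// geomean0l.
rewrite -ltNge => fpos.
have [gneg|/existsNP[xg /negP]] := pselect (forall x, g x <= 0).
  by rewrite (I0 g)// geomean0r.
rewrite -ltNge => gpos.
pose a := sup (range f); pose b := sup (range g).
have fa x : f x <= a by apply: ub_le_sup => //; exists x.
have gb x : g x <= b by apply: ub_le_sup => //; exists x.
have a0 : 0 < a by exact: lt_le_trans (fa xf).
have b0 : 0 < b by exact: lt_le_trans (gb xg).
pose c := geomean l a b.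
have c0 : 0 < c by rewrite mulr_gt0 ?powR_gt0.
have divC (k : R -> R) (z : R) : 0 < z -> measurable_fun setT k -> (forall x, 0 <= k x) ->
    (\int[mu]_x (k x)%:E < +oo)%E ->
    (\int[mu]_x (k x / z)%:E = ((\int[mu]_x k x) / z)%:E)%E.
  move=> z0 mk k0 koo; rewrite EFinM fineK; last first.
    by rewrite ge0_fin_numE// integral_ge0// => x _; rewrite lee_fin.
  rewrite -ge0_integralZr//.
  - exact/measurable_EFinP.
  - by move=> x _; rewrite lee_fin.
  - by rewrite lee_fin invr_ge0 ltW.
have lt_div (z t u : R) : 0 < z -> (t < u / z) = (t * z < u).
  by move=> z0; rewrite ltr_pdivlMr.
have sup_div (k : R -> R) t : 0 < sup (range k) -> has_ubound (range k) ->
    t < 1 -> exists x, t < k x / sup (range k).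
  move=> s0 ubk t1; have : t * sup (range k) < sup (range k) by rewrite gtr_pMl.
  move=> /sup_gt[|_ [x _ <-] tx]; first by exists (k 0), 0.
  by exists x; rewrite lt_div.
have := @prekopa_leindler_normalized R (fun x => f x / a) (fun x => g x / b)
  (fun x => h x / c) l l01.
rewrite !divC// -!EFinM -EFinD lee_fin => PL.
have F0 : 0 <= \int[mu]_x f x by apply: Rintegral_ge0 => x _; exact: f0.
have G0 : 0 <= \int[mu]_x g x by apply: Rintegral_ge0 => x _; exact: g0.
rewrite -[leRHS](divfK (lt0r_neq0 c0)) -[X in geomean l X](divfK (lt0r_neq0 a0)).
rewrite -[X in geomean l _ X](divfK (lt0r_neq0 b0)).
rewrite geomeanM ?divr_ge0 ?(ltW a0) ?(ltW b0)// ler_pM2r//.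
apply: le_trans (geomean_le_arith l01 _ _) _; rewrite ?divr_ge0 ?(ltW a0) ?(ltW b0)//.
apply: PL.
- by apply: measurable_funM.
- by apply: measurable_funM.
- by apply: measurable_funM.
- by move=> x; rewrite divr_ge0 ?(ltW a0)//= ler_pdivrMr// mul1r.
- by move=> x; rewrite divr_ge0 ?(ltW b0)//= ler_pdivrMr// mul1r.
- by move=> x; rewrite divr_ge0// ltW.
- by move=> t; exact: sup_div.
- by move=> t; exact: sup_div.
- move=> t; rewrite (_ : [set x | _] = [set x | t * a < f x]); last first.
    by apply/seteqP; split => x /=; rewrite lt_div.
  exact: log_concave_is_interval.
- move=> t; rewrite (_ : [set x | _] = [set x | t * b < g x]); last first.
    by apply/seteqP; split => x /=; rewrite lt_div.
  exact: log_concave_is_interval.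
- move=> t x y t0 tf tg; rewrite lt_div//.
  (* As m a <= f x and m b <= g y, m c = geomean l (m a) (m b) <= geomean l (f x) (g y), while t <
     m. *)
  apply: lt_le_trans (fgh x y); pose m := Num.min (f x / a) (g y / b).
  have tm : t < m by rewrite lt_min tf.
  have m0 : 0 <= m by rewrite (le_trans t0)// ltW.
  apply: (@lt_le_trans _ _ (m * c)); first by rewrite ltr_pM2r.
  rewrite -[m](geomeanxx l)// -geomeanM ?(ltW a0) ?(ltW b0)//.
  by apply: le_geomean => //; rewrite mulr_ge0 ?(ltW a0) ?(ltW b0)//= -ler_pdivlMr//
    ge_min lexx ?orbT.
Qed.

End prekopa_leindler.

(** * Log-concavity and monotonicity of box probabilities *)

Section box_log_concave.
Context d (T : measurableType d) (R : realType) (P : probability T R).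
Local Notation mu := (@lebesgue_measure R).
Local Notation p := (normal_pdf (0 : R) 1).

Definition box m (Z : 'I_m -> T -> R) (w : 'I_m -> R) : set T :=
  [set t | forall i, `|Z i t + w i| <= 1].

Lemma measurable_box_line m (Z : 'I_m -> T -> R) (b v : 'I_m -> R) :
  (forall i, measurable_fun setT (Z i)) ->
  measurable_fun setT (fun x : R => P (box Z (fun i => b i * x + v i))).
Proof.
move=> mZ; pose S := [set z : R * T | forall i, `|Z i z.2 + (b i * z.1 + v i)| <= 1].
have mS : measurable S.
  apply: measurable_slabs => i; apply: measurable_funD.
    exact: (measurableT_comp (mZ i)).
  by apply: measurable_funD => //; exact: measurable_funM.
have := measurable_fun_xsection P mS.
rewrite (_ : (fun x => _) = fun x => P (xsection S x))//.
apply/funext => x; congr (P _); apply/seteqP; split => t;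
  by rewrite /xsection/= inE.
Qed.

Lemma measurable_box m (Z : 'I_m -> T -> R) w :
  (forall i, measurable_fun setT (Z i)) -> measurable (box Z w).
Proof. by move=> mZ; apply: measurable_slabs => i; exact: measurable_funD. Qed.

Lemma pdf_log_concave : log_concave p.
Proof.
move=> l x y /andP[l0 l1]; rewrite !normal_pdf_stdE geomeanM ?expR_ge0 ?normal_peak_ge0//.
rewrite geomeanxx ?normal_peak_ge0// ler_wpM2l ?normal_peak_ge0//.
rewrite geomean_expR ler_expR.
have l1' : 0 <= 1 - l by rewrite subr_ge0 ltW.
have := mulr_ge0 (mulr_ge0 l1' (ltW l0)) (sqr_ge0 (x - y)).
lra.
Qed.

Lemma interval_log_concave (s l x y v w : R) : 0 < l < 1 ->
  geomean l (`|s * x + v| <= 1)%R%:R (`|s * y + w| <= 1)%R%:R <=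
  (`|s * ((1 - l) * x + l * y) + ((1 - l) * v + l * w)| <= 1)%R%:R :> R.
Proof.
move=> /andP[l0 l1].
have [h1|_] := boolP (`|s * x + v| <= 1); last by rewrite geomean0l.
have [h2|_] := boolP (`|s * y + w| <= 1); last by rewrite geomean0r.
rewrite geomeanxx// (_ : `|_| <= 1)//.
have -> : s * ((1 - l) * x + l * y) + ((1 - l) * v + l * w) =
  (1 - l) * (s * x + v) + l * (s * y + w) by ring.
have l1' : 0 <= 1 - l by rewrite subr_ge0 ltW.
rewrite (le_trans (ler_normD _ _))// !normrM (ger0_norm l1') (gtr0_norm l0).
by have := ler_wpM2l l1' h1; have := ler_wpM2l (ltW l0) h2; lra.
Qed.

(** Given the first coordinate s x, the others form a box of the residuals with offset
    [b i * (s * x) + u (lift ord0 i)], affine in x and u together; the induction hypothesis thus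
    applies to the slices and Prekopa-Leindler integrates x out. *)
Lemma box_log_concave n (X : 'I_n -> T -> R) : jointly_gaussian P X ->
  forall l (v w : 'I_n -> R), 0 < l < 1 ->
  geomean l (fine (P (box X v))) (fine (P (box X w))) <=
  fine (P (box X (fun i => (1 - l) * v i + l * w i))).
Proof.
elim: n X => [|n IH] X gX l v w l01.
  have E u : box X u = setT by apply/seteqP; split => t //= _ [].
  by rewrite !E probability_setT geomeanxx.
pose Y := X ord0; pose X' (i : 'I_n) := X (lift ord0 i).
have [mX lX] := gX.
have gYX : jointly_gaussian2 P Y X'.
  split=> [|i|a c]; [exact: mX|exact: mX|].
  have := lX (fun i => if unlift ord0 i is Some j then c j else a).
  rewrite (_ : (fun t => _) = fun t => a * Y t + \sum_(i < n) c i * X' i t)//.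
  apply/funext => t; rewrite big_ord_recl unlift_none; congr (_ + _).
  by apply: eq_bigr => i _; rewrite liftK.
have mY : measurable_fun setT Y by exact: mX.
have gY : centered_gaussian P Y.
  case: gYX => _ _ /(_ 1 (fun=> 0)).
  rewrite (_ : (fun t => _) = Y)//; apply/funext => t.
  by rewrite mul1r big1 ?addr0// => i _; rewrite mul0r.
have [s s0 sY] := centered_gaussian_integral mY gY.
pose b := regression P Y X'; pose Z := residual P Y X'.
have gZ : jointly_gaussian P Z by exact: jointly_gaussian_residual gYX.
have [mZ _] := gZ.
pose F (u : 'I_n.+1 -> R) (x : R) := (`|s * x + u ord0| <= 1)%R%:R *
  fine (P (box Z (fun i => b i * (s * x) + u (lift ord0 i)))) * p x.
have finZ w' : P (box Z w') \is a fin_num.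
  by apply: fin_num_measure; exact: measurable_box.
have finX w' : P (box X w') \is a fin_num.
  by apply: fin_num_measure; exact: measurable_box.
have mF0 (r : R) : measurable_fun setT (fun y : R => (`|y + r| <= 1)%R%:R : R).
  rewrite (_ : (fun y => _) = \1_(`[-1 - r, 1 - r]%classic)).
    exact: measurable_indic.
  apply/funext => y; rewrite indicE; congr ((nat_of_bool _)%:R).
  rewrite mem_setE in_itv/= ler_norml.
  by apply/idP/idP => /andP[h1 h2]; apply/andP; split; lra.
pose G (u : 'I_n.+1 -> R) (y : R) := P (box Z (fun i => b i * y + u (lift ord0 i))).
have mF1 u : measurable_fun setT (G u) by exact: measurable_box_line.
have F0 u x : 0 <= F u x by rewrite !mulr_ge0 ?fine_ge0 ?normal_pdf_ge0.
have ms : measurable_fun setT (fun x : R => s * x) by exact: measurable_funM.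
have mF u : measurable_fun setT (F u).
  apply: measurable_funM; last exact: measurable_normal_pdf.
  apply: measurable_funM.
    exact: (measurableT_comp (mF0 (u ord0)) ms).
  apply: (measurableT_comp (f := fine)) => //.
  exact: (measurableT_comp (mF1 u) ms).
have boxE u : P (box X u) = (\int[mu]_x (F u x)%:E)%E.
  transitivity (P [set t | `|1 * Y t + u ord0| <= 1 /\
      forall i, `|X' i t + u (lift ord0 i)| <= 1]).
    congr (P _); apply/seteqP; split => t /=.
      by move=> h; split => [|i]; [rewrite mul1r; exact: h|exact: h].
    move=> [h0 h] i; have [j ->|->] := unliftP ord0 i; first exact: h.
    by move: h0; rewrite mul1r.
  rewrite (box_decomposition gYX 1 (u ord0) (fun i => u (lift ord0 i))).
  pose h y := ((`|y + u ord0| <= 1)%R%:R%:E * G u y)%E.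
  have mh : measurable_fun setT h.
    by apply: emeasurable_funM => //; apply/measurable_EFinP; exact: mF0.
  have h0 y : (0 <= h y)%E by rewrite mule_ge0// lee_fin.
  transitivity (\int[P]_t h (Y t))%E.
    by apply: eq_integral => t _; rewrite mul1r.
  rewrite (sY h mh h0); apply: eq_integral => x _.
  by rewrite /F 2!EFinM fineK.
have fineE u : fine (P (box X u)) = \int[mu]_x F u x by rewrite boxE.
have Foo u : (\int[mu]_x (F u x)%:E < +oo)%E.
  by rewrite -boxE -ge0_fin_numE.
have fine_le1 w' : fine (P (box Z w')) <= 1.
  by rewrite -lee_fin fineK// probability_le1//; exact: measurable_box.
have Fub u : has_ubound (range (F u)).
  exists (normal_peak 1) => _ [x _ <-].
  rewrite -[leRHS]mul1r ler_pM ?mulr_ge0 ?fine_ge0 ?normal_pdf_ge0//.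
    by rewrite mulr_ile1 ?fine_ge0 ?lern1 ?leq_b1.
  by rewrite normal_pdf_ub ?oner_neq0.
(* Joint log-concavity in offset and x, factor by factor: indicator, induction hypothesis, density.
   Taking u1 = u2 gives the log-concavity in x that [prekopa_leindler] asks for. *)
have FF k u1 u2 x y : 0 < k < 1 -> geomean k (F u1 x) (F u2 y) <=
    F (fun i => (1 - k) * u1 i + k * u2 i) ((1 - k) * x + k * y).
  move=> k01.
  rewrite /F !geomeanM ?mulr_ge0 ?fine_ge0 ?normal_pdf_ge0//.
  apply: (ler_pM (mulr_ge0 (geomean_ge0 _ _ _) (geomean_ge0 _ _ _))
    (geomean_ge0 _ _ _) _ (pdf_log_concave x y k01)).
  apply: ler_pM; rewrite ?geomean_ge0//; first exact: interval_log_concave.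
  apply: le_trans (IH Z gZ k _ _ k01) _.
  rewrite (_ : (fun i => _) = fun i => b i * (s * ((1 - k) * x + k * y)) +
    ((1 - k) * u1 (lift ord0 i) + k * u2 (lift ord0 i)))//.
  by apply/funext => i; ring.
rewrite !fineE; apply: prekopa_leindler => //.
- move=> k x y /(FF k v v x y); rewrite (_ : (fun i => _) = v)//.
  by apply/funext => i; ring.
- move=> k x y /(FF k w w x y); rewrite (_ : (fun i => _) = w)//.
  by apply/funext => i; ring.
- by move=> x y; exact: FF.
Qed.

End box_log_concave.

(** * Widening slabs, one coordinate at a time *)

Section slab.
Context d (T : measurableType d) (R : realType) (P : probability T R).
Local Notation mu := (@lebesgue_measure R).
Local Notation p := (normal_pdf (0 : R) 1).

Lemma box_line_nonincreasing n (Z : 'I_n -> T -> R) (b : 'I_n -> R) (x y : R) :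
  jointly_gaussian P Z -> `|x| <= `|y| ->
  (P (box Z (fun i => b i * y)%R) <= P (box Z (fun i => b i * x)%R))%E.
Proof.
move=> gZ xy; have [mZ _] := gZ.
have finZ w : P (box Z w) \is a fin_num.
  by apply: fin_num_measure; exact: measurable_box.
have sym z : P (box Z (fun i => b i * - z)) = P (box Z (fun i => b i * z)).
  have <- := box_symmetry (fun i => b i * z) gZ.
  by congr (P _); apply/seteqP; split => t /= h i; have := h i; rewrite mulrN.
rewrite -(fineK (finZ _)) -[leRHS](fineK (finZ _)) lee_fin.
have [y0|y0] := eqVneq y 0.
  by move: xy; rewrite y0 normr0 normr_le0 => /eqP ->.
(* Makes x the combination (1 - l) y + l (-y); by evenness both ends have the same probability. The
   values l = 0 and l = 1, that is x = y and x = -y, lie outside the range of log-concavity. *)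
pose l := (1 - x / y) / 2.
have xyE : x = (1 - l) * y + l * - y by rewrite /l; field.
have : `|x / y| <= 1 by rewrite normrM normfV ler_pdivrMr ?normr_gt0// mul1r.
rewrite ler_norml => /andP[xy1 xy2].
have [/eqP|l0] := eqVneq l 0.
  by move=> /eqP l0; rewrite xyE l0 subr0 mul1r mul0r addr0.
have [/eqP|l1] := eqVneq l 1.
  by move=> /eqP l1; rewrite xyE l1 subrr mul0r add0r mul1r sym.
have l01 : 0 < l < 1.
  by rewrite !lt_neqAle eq_sym l0 l1/= /l; apply/andP; split; lra.
have := box_log_concave gZ (fun i => b i * y) (fun i => b i * - y) l01.
rewrite sym geomeanxx ?fine_ge0// => /le_trans; apply.
rewrite (_ : (fun i => _) = (fun i => b i * x))//.
by apply/funext => i; rewrite xyE; ring.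
Qed.

(** Comparison of averages without division: the claim reduces to A J <= B I, and A J <= A (c B) =
    (c A) B <= B I. *)
Lemma ratio_le_aux (A B I J c : \bar R) : (0 <= A)%E -> (0 <= B)%E -> (0 <= I)%E ->
  (0 <= J)%E -> (c * A <= I)%E -> (J <= c * B)%E -> (A * (I + J) <= (A + B) * I)%E.
Proof.
move=> A0 B0 I0 J0 cAI JcB; rewrite ge0_muleDr// ge0_muleDl// leeD2l//.
apply: (@le_trans _ _ (A * (c * B))%E); first exact: lee_wpmul2l.
by rewrite muleA [(A * c)%E]muleC [leLHS]muleC lee_wpmul2l.
Qed.

(* With [psi y] the probability of the other constraints given [X j = y], the
   mass of [|X j|] beyond 1 sees values of [psi] at most [psi 1], the mass below 1
   values at least [psi 1]. *)
Lemma slab_box n (X : 'I_n -> T -> R) (j : 'I_n) (k : R) :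
  jointly_gaussian P X -> 0 <= k <= 1 ->
  (P [set t | (`|X j t| <= 1)%R] *
   P [set t | (`|k * X j t| <= 1)%R /\ forall i, i != j -> (`|X i t| <= 1)%R] <=
   P [set t | (`|k * X j t| <= 1)%R] * P [set t | forall i, (`|X i t| <= 1)%R])%E.
Proof.
move=> gX /andP[k0 k1]; have [mX lX] := gX.
(* Zeroing coordinate j makes its constraint trivially true, which avoids reindexing over i != j. *)
pose X' (i : 'I_n) := if i == j then fun=> 0 else X i.
have mX' i : measurable_fun setT (X' i) by rewrite /X'; case: ifP.
have gYX : jointly_gaussian2 P (X j) X'.
  split=> // a c; have := lX (fun i => if i == j then a else c i).
  rewrite (_ : (fun t => _) = fun t => a * X j t + \sum_(i < n) c i * X' i t)//.
  apply/funext => t; rewrite (bigD1 j)//= eqxx [in RHS](bigD1 j)//= /X' eqxx.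
  rewrite mulr0 add0r; congr (_ + _).
  by apply: eq_bigr => i /negPf ij; rewrite ij.
pose Y := X j; pose b := regression P Y X'; pose Z := residual P Y X'.
have gZ : jointly_gaussian P Z by exact: jointly_gaussian_residual gYX.
have [mZ _] := gZ.
pose psi y := P (box Z (fun i => b i * y)).
have mpsi : measurable_fun setT psi.
  rewrite (_ : psi = fun y => P (box Z (fun i => b i * y + 0))).
    exact: measurable_box_line.
  apply/funext => y; rewrite /psi; congr (P (box _ _)).
  by apply/funext => i; rewrite addr0.
have eventE c : [set t | `|c * Y t| <= 1 /\ forall i, i != j -> `|X i t| <= 1] =
    [set t | `|c * Y t + 0| <= 1 /\ forall i, `|X' i t + 0| <= 1].
  apply/seteqP; split => t /= [h0 h]; split => [|i]; rewrite ?addr0//.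
  - by rewrite /X'; case: ifPn => ij; [rewrite normr0|exact: h].
  - by move: h0; rewrite addr0.
  - by move=> /negPf ij; have := h i; rewrite addr0 /X' ij.
pose ind (c : R) t : \bar R := (`|c * Y t| <= 1)%R%:R%:E.
have mY : measurable_fun setT Y by exact: mX.
have mslab c : measurable [set t | `|c * Y t| <= 1].
  by apply: measurable_slab; exact: measurable_funM.
have mind c : measurable_fun setT (ind c).
  apply/measurable_EFinP.
  rewrite (_ : (fun t => _) = \1_[set t | `|c * Y t| <= 1]); first exact: measurable_indic.
  by apply/funext => t; rewrite indic_bool.
have ind0 c t : (0 <= ind c t)%E by rewrite lee_fin.
have slabE c : P [set t | `|c * Y t| <= 1] = (\int[P]_t ind c t)%E.
  transitivity (\int[P]_t (\1_[set t | `|c * Y t| <= 1] t)%:E)%E.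
    by rewrite integral_indic// setIT.
  by apply: eq_integral => t _; rewrite indic_bool.
have psi0 y : (0 <= psi y)%E by [].
have mpsiY : measurable_fun setT (fun t => psi (Y t)).
  exact: (measurableT_comp mpsi (mX j)).
have boxE c : P [set t | `|c * Y t| <= 1 /\ forall i, i != j -> `|X i t| <= 1] =
    (\int[P]_t (ind c t * psi (Y t)))%E.
  rewrite eventE (box_decomposition gYX c 0 (fun=> 0)).
  apply: eq_integral => t _; rewrite /ind addr0; congr (_ * P _)%E.
  by apply/seteqP; split => t' /= h i; have := h i; rewrite addr0.
have box1E : P [set t | forall i, `|X i t| <= 1] = (\int[P]_t (ind 1%R t * psi (Y t)))%E.
  rewrite -boxE; congr (P _); apply/seteqP; split => t /=.
    by move=> h; split; [rewrite mul1r; exact: h|move=> i _; exact: h].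
  move=> [h0 h] i; have [->|/h//] := eqVneq i j.
  by move: h0; rewrite mul1r.
rewrite (_ : [set t | `|X j t| <= 1] = [set t | `|1 * Y t| <= 1]); last first.
  by apply/seteqP; split => t /=; rewrite mul1r.
rewrite -/Y boxE box1E !slabE.
(* As 0 <= k <= 1, |Y| <= 1 implies |k Y| <= 1; [rest] is the indicator of the difference of these
   two events. *)
pose rest t := (((`|k * Y t| <= 1) && (1 < `|Y t|))%:R%:E : \bar R).
have indk t : ind k t = (ind 1%R t + rest t)%E.
  rewrite /ind /rest -EFinD -natrD mul1r; congr (_%:R%:E).
  have [Y1|Y1] /= := leP (`|Y t|) 1; last by rewrite andbT.
  by rewrite andbF addn0 normrM (ger0_norm k0) mulr_ile1.
have rest0 t : (0 <= rest t)%E by rewrite lee_fin.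
have restE : rest = (fun t => ind k t - ind 1%R t)%E.
  by apply/funext => t; rewrite indk addeAC subee ?add0e.
have mrest : measurable_fun setT rest.
  by rewrite restE; apply: emeasurable_funB.
have fin_ind c : (\int[P]_t ind c t)%E \is a fin_num.
  by rewrite -slabE; apply: fin_num_measure.
have kE : (\int[P]_t ind k t = \int[P]_t ind 1%R t + \int[P]_t rest t)%E.
  by rewrite -ge0_integralD//; apply: eq_integral => t _; exact: indk.
have kpsiE : (\int[P]_t (ind k t * psi (Y t)) =
    \int[P]_t (ind 1%R t * psi (Y t)) + \int[P]_t (rest t * psi (Y t)))%E.
  rewrite -ge0_integralD//; [|by move=> t _; rewrite mule_ge0|exact: emeasurable_funM|
      by move=> t _; rewrite mule_ge0|exact: emeasurable_funM].
  by apply: eq_integral => t _; rewrite indk ge0_muleDl.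
have lower : (psi 1%R * \int[P]_t ind 1%R t <= \int[P]_t (ind 1%R t * psi (Y t)))%E.
  rewrite -ge0_integralZl//; apply: ge0_le_integral => //.
  - by move=> t _; rewrite mule_ge0.
  - exact: emeasurable_funM.
  - exact: emeasurable_funM.
  move=> t _; rewrite /ind mul1r; have [Yt|_] := boolP (`|Y t| <= 1).
    rewrite mule1 mul1e; apply: box_line_nonincreasing => //.
    by rewrite normr1.
  by rewrite mule0 mul0e.
have upper : (\int[P]_t (rest t * psi (Y t)) <= psi 1%R * \int[P]_t rest t)%E.
  rewrite -ge0_integralZl//; apply: ge0_le_integral => //.
  - by move=> t _; rewrite mule_ge0.
  - exact: emeasurable_funM.
  - exact: emeasurable_funM.
  move=> t _; rewrite /rest; have [/andP[_ Yt]|_] := boolP (_ && _).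
    rewrite mule1 mul1e; apply: box_line_nonincreasing => //.
    by rewrite normr1 ltW.
  by rewrite mule0 mul0e.
rewrite kpsiE kE; apply: (ratio_le_aux (c := psi 1)) => //.
- by apply: integral_ge0.
- by apply: integral_ge0.
- by apply: integral_ge0 => t _; rewrite mule_ge0.
- by apply: integral_ge0 => t _; rewrite mule_ge0.
Qed.

(** Serves for the denominators of [box_ratio]. *)
Lemma gaussian_slab_gt0 (V : T -> R) : measurable_fun setT V ->
  centered_gaussian P V -> (0 < P [set t | (`|V t| <= 1)%R])%E.
Proof.
move=> mV gV; have [s s0 sV] := centered_gaussian_integral mV gV.
pose A : set R := `[-1, 1]%classic.
have mA : measurable A by exact: measurable_itv.
have -> : P [set t | `|V t| <= 1] = (\int[mu]_x ((\1_A (s * x)%R)%:E * (p x)%:E))%E.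
  rewrite -(sV (fun y => (\1_A y)%:E)).
  - rewrite (_ : (fun t => _) = fun t => (\1_(V @^-1` A) t)%:E)//.
    have mVA : measurable (V @^-1` A) by rewrite -[X in measurable X]setTI; exact: mV.
    rewrite integral_indic// setIT; congr (P _).
    by apply/seteqP; split => t /=; rewrite /A/= in_itv/= ler_norml.
  - by apply/measurable_EFinP; exact: measurable_indic.
  - by move=> x; rewrite lee_fin.
have mf : measurable_fun setT (fun x : R => ((\1_A (s * x)%R)%:E * (p x)%:E)%E).
  apply: emeasurable_funM; last exact: measurable_pdf.
  have mI : measurable_fun setT (\1_A : R -> R) by exact: measurable_indic.
  have ms : measurable_fun setT (fun x : R => s * x) by exact: measurable_funM.
  by apply/measurable_EFinP; exact: (measurableT_comp mI ms).
(* On [0, del] both s x <= 1 and x <= 1 hold, also when s = 0, so the integrand is at least p 1. *)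
pose del := (s + 1)^-1.
have s1 : 0 < s + 1 by rewrite ltr_wpDl.
have del0 : 0 < del by rewrite invr_gt0.
have p1 : 0 < p 1.
  by rewrite normal_pdf_stdE mulr_gt0 ?expR_gt0// normal_peak_gt0// oner_neq0.
apply: (@lt_le_trans _ _ (\int[mu]_(x in `[0%R, del]) (p 1)%:E)%E).
  rewrite integral_cst//= lebesgue_measure_itv/= lte_fin del0.
  by rewrite sube0 -EFinM lte_fin mulr_gt0.
apply: (@le_trans _ _ (\int[mu]_(x in `[0%R, del]) ((\1_A (s * x)%R)%:E * (p x)%:E))%E).
  apply: ge0_le_integral => //.
  - by move=> x _; rewrite lee_fin ltW.
  - exact: measurable_funTS.
  - move=> x /=; rewrite in_itv/= => /andP[x0 xd].
    have sx1 : (s + 1) * x <= 1 by rewrite mulrC -ler_pdivlMr// div1r.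
    have sx0 : 0 <= s * x by rewrite mulr_ge0.
    rewrite indicE mem_set; last by rewrite /A/= in_itv/=; apply/andP; split; lra.
    rewrite mul1e lee_fin !normal_pdf_stdE ler_wpM2l ?normal_peak_ge0// ler_expR.
    rewrite ler_pM2r ?invr_gt0// lerN2 ler_sqr ?nnegrE//; lra.
apply: ge0_subset_integral => //.
by move=> x _; rewrite mule_ge0 ?pdf_ge0// lee_fin.
Qed.

(** The list r holds the coordinates whose factor has been reset from k i to 1; each new one costs a
    use of [slab_box]. *)
Lemma slab_box_prod n (X : 'I_n -> T -> R) (k : 'I_n -> R) :
  jointly_gaussian P X -> (forall i, 0 <= k i <= 1) -> forall r : seq 'I_n, uniq r ->
  fine (P [set t | forall i, `|k i * X i t| <= 1]) *
    \prod_(i <- r) fine (P [set t | `|X i t| <= 1]) <=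
  fine (P [set t | forall i, `|(if i \in r then 1 else k i) * X i t| <= 1]) *
    \prod_(i <- r) fine (P [set t | `|k i * X i t| <= 1]).
Proof.
move=> gX k01; have [mX lX] := gX; elim=> [_|j r IH /= /andP[jr ur]].
  by rewrite !big_nil.
(* [slab_box] is applied to the vector of the K i X i. Since K j = 1 and j is not in r, multiplying
   coordinate j by k j gives back the box for r. *)
pose K i := if i \in j :: r then 1 else k i.
have gK : jointly_gaussian P (fun i t => K i * X i t).
  split=> [i|c]; first exact: measurable_funM.
  have := lX (fun i => c i * K i).
  rewrite (_ : (fun t => _) = fun t => \sum_(i < n) c i * (K i * X i t))//.
  by apply/funext => t; apply: eq_bigr => i _; rewrite mulrA.
have := slab_box j gK (k01 j).
rewrite (_ : [set t | (`|K j * X j t| <= 1)%R] = [set t | `|X j t| <= 1]); last first.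
  by apply/seteqP; split => t /=; rewrite /K mem_head mul1r.
rewrite (_ : [set t | (`|k j * (K j * X j t)| <= 1)%R] = [set t | `|k j * X j t| <= 1]); last first.
  by apply/seteqP; split => t /=; rewrite /K mem_head mul1r.
rewrite (_ : [set t | _ /\ _] =
  [set t | forall i, `|(if i \in r then 1 else k i) * X i t| <= 1]); last first.
  apply/seteqP; split => t /=.
    rewrite /K mem_head mul1r => -[h0 h] i.
    have [->|ij] := eqVneq i j; first by rewrite (negPf jr).
    by have := h i ij; rewrite inE (negPf ij).
  move=> h; rewrite /K mem_head mul1r; split => [|i ij].
    by have := h j; rewrite (negPf jr).
  by rewrite inE (negPf ij); exact: h.
have fin_slab c i : P [set t | `|c * X i t| <= 1] \is a fin_num.
  by apply/fin_num_measure/measurable_slab; exact: measurable_funM.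
have fin_slab1 i : P [set t | `|X i t| <= 1] \is a fin_num.
  by have := fin_slab 1 i; under eq_set do rewrite mul1r.
have fin_box c : P [set t | forall i, `|c i * X i t| <= 1] \is a fin_num.
  by apply/fin_num_measure/measurable_slabs => i; exact: measurable_funM.
move=> h; have {}h : fine (P [set t | `|X j t| <= 1]) *
    fine (P [set t | forall i, `|(if i \in r then 1 else k i) * X i t| <= 1]) <=
    fine (P [set t | `|k j * X j t| <= 1]) * fine (P [set t | forall i, `|K i * X i t| <= 1]).
  by rewrite -lee_fin !EFinM !fineK.
rewrite !big_cons mulrCA; have {IH} := IH ur.
set N := fine (P _); set Q := \prod_(_ <- _) _; set N' := fine _; set Q' := \prod_(_ <- _) _.
move=> IH; apply: le_trans (ler_wpM2l _ IH) _; first exact: fine_ge0.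
rewrite [leRHS]mulrCA 2!mulrA ler_wpM2r//.
by apply: prodr_ge0 => i _; exact: fine_ge0.
Qed.

End slab.

(* Variables X_1..X_n are indexed by 'I_n.+1 (so n+1 = the paper's n >= 1);
   X_1 is X ord0. *)
Theorem theorem1p1 (d : measure_display) (T : measurableType d) (R : realType)
  (P : probability T R) (n : nat) (X : 'I_n.+1 -> T -> R) :
  jointly_gaussian P X ->
  (forall a : \bar R, (0 < a)%E ->
     (P [set t | (`|X ord0 t|%:E <= 1 + a)%E] *
      P [set t | forall i, (`|X i t| <= 1)%R]
      >=
      P [set t | (`|X ord0 t| <= 1)%R] *
      P [set t | (`|X ord0 t|%:E <= 1 + a)%E /\
                 forall i, i != ord0 -> (`|X i t| <= 1)%R])%E)
  /\
  ((box_ratio P X (fun=> 0))%:E >=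
     ereal_sup [set (box_ratio P X b)%:E | b in [set b | forall i, (0 < b i)%R]])%E.
Proof.
move=> gX; have [mX lX] := gX; split=> [a a0|].
  (* k = 1 / (1 + a), or k = 0 when a = +oo, where both sides are always true. *)
  have [k k01 kE] : exists2 k : R, 0 <= k <= 1 &
      forall x : R, (x%:E <= 1 + a)%E = (k * x <= 1).
    move: a a0 => [a| |]//.
      rewrite lte_fin => a0; have a1 : 0 < 1 + a by rewrite addr_gt0.
      exists (1 + a)^-1 => [|x]; first by rewrite invr_ge0 ltW//= invf_le1// lerDl ltW.
      by rewrite -EFinD lee_fin mulrC ler_pdivrMr// mul1r.
    by exists 0 => [|x]; rewrite ?lexx ?ler01// mul0r ler01 leey.
  have /andP[k0 _] := k01.
  have absE t : (`|X ord0 t|%:E <= 1 + a)%E = (`|k * X ord0 t| <= 1)%R.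
    by rewrite kE normrM ger0_norm.
  rewrite (_ : [set t | (`|X ord0 t|%:E <= 1 + a)%E] =
    [set t | `|k * X ord0 t| <= 1]); last first.
    by apply/seteqP; split => t /=; rewrite absE.
  rewrite (_ : [set t | _ /\ _] =
    [set t | `|k * X ord0 t| <= 1 /\ forall i, i != ord0 -> `|X i t| <= 1]); last first.
    by apply/seteqP; split => t /=; rewrite absE.
  exact: slab_box.
apply: ge_ereal_sup => _ [b b0 <-]; rewrite lee_fin /box_ratio.
pose k i := (1 + b i)^-1.
have b1 i : 0 < 1 + b i by rewrite addr_gt0.
have k01 i : 0 <= k i <= 1 by rewrite invr_ge0 ltW//= invf_le1// lerDl ltW.
have kE i x : (`|x| <= 1 + b i) = (`|k i * x| <= 1).
  by rewrite normrM gtr0_norm ?invr_gt0// mulrC ler_pdivrMr// mul1r.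
have slab_gt0 c i : 0 < c -> 0 < fine (P [set t | `|X i t| <= c]).
  move=> c0; have -> : [set t | `|X i t| <= c] = [set t | `|c^-1 * X i t| <= 1].
    by apply/seteqP; split => t /=; rewrite normrM gtr0_norm ?invr_gt0//
      mulrC ler_pdivrMr// mul1r.
  have mV : measurable_fun setT (fun t => c^-1 * X i t) by exact: measurable_funM.
  have gV : centered_gaussian P (fun t => c^-1 * X i t).
    have := lX (fun j => (j == i)%:R * c^-1).
    rewrite (_ : (fun t => _) = fun t => c^-1 * X i t)//; apply/funext => t.
    rewrite (bigD1 i)//= eqxx mul1r big1 ?addr0// => j /negPf ->.
    by rewrite !mul0r.
  rewrite fine_gt0// gaussian_slab_gt0//=.
  apply: le_lt_trans (ltry 1); apply: probability_le1.
  exact: measurable_slab.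
(* With r the full enumeration, every factor has become 1. *)
have := slab_box_prod gX k01 (enum_uniq 'I_n.+1).
rewrite !big_enum/=.
rewrite (_ : [set t | forall i, `|(if _ then 1 else k i) * X i t| <= 1] =
  [set t | forall i, `|X i t| <= 1 + 0]); last first.
  by apply/seteqP; split => t /= h i; have := h i; rewrite mem_enum/= mul1r addr0.
rewrite (_ : [set t | forall i, `|k i * X i t| <= 1] =
  [set t | forall i, `|X i t| <= 1 + b i]); last first.
  by apply/seteqP; split => t /= h i; have := h i; rewrite kE.
rewrite (eq_bigr (fun i => fine (P [set t | `|X i t| <= 1 + 0]))); last first.
  by move=> i _; rewrite addr0.
rewrite [X in (_ <= _ * X) -> _](eq_bigr (fun i => fine (P [set t | `|X i t| <= 1 + b i]))); last first.
  by move=> i _; congr (fine (P _)); apply/seteqP; split => t /=; rewrite kE.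
move=> h; rewrite ler_pdivrMr; last by apply: prodr_gt0 => i _; exact: slab_gt0.
rewrite mulrAC ler_pdivlMr//; apply: prodr_gt0 => i _.
by apply: slab_gt0; rewrite addr0.
Qed.
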